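(* There exist continuum many isomorphism types of finitely generated simple left orderable groups.
   Context: A group is left orderable if it admits a total order that is invariant under left multiplication. *)

(* Defs.v *)
From mathcomp Require Import all_boot.
From mathcomp Require Import boolp classical_sets functions cardinality reals.

Set Implicit Arguments.
Unset Strict Implicit.
Unset Printing Implicit Defensive.

Local Open Scope classical_set_scope.
Local Open Scope group_scope.

(* The only subgroup containing [A] is [G]. *)
Definition generates (G : groupType) (A : set G) : Prop :=
  forall S : set G, group_closed (mem S) -> A `<=` S -> S = setT.

Definition finitely_generated (G : groupType) : Prop :=
  exists2 A : set G, finite_set A & generates A.

Definition normal_subgroup (G : groupType) (N : set G) : Prop :=
  group_closed (mem N) /\ (forall x y : G, N x -> N (x ^ y)).

Definition simple_group (G : groupType) : Prop :=
  [set: G] <> [set 1] /\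
  (forall N : set G, normal_subgroup N -> N = [set 1] \/ N = setT).

(* Reflexivity of [le] is part of [total]. *)
Definition left_orderable (G : groupType) : Prop :=
  exists le : rel G,
    [/\ antisymmetric le, transitive le, total le
      & forall x y z : G, le x y -> le (z * x) (z * y)].

Definition isomorphic (G H : groupType) : Prop :=
  exists f : {multiplicative G -> H}, bijective f.

(* The isomorphism classes of the groups satisfying [P]. A class is a plain
   predicate because [set groupType] is a universe inconsistency; for the same
   reason cardinalities of such types cannot be compared with [#=]. *)
Definition isomorphism_types (P : groupType -> Prop) : Type :=
  {C : groupType -> Prop | exists2 G, P G & C = isomorphic G}.

(* [T] has exactly the cardinality of the real line. *)
Definition continuum_many (R : realType) (T : Type) : Prop :=
  exists f : R -> T, bijective f.

(* Main.v *)
(** The groups act on an ordered field by order automorphisms; over [rat] such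
    a group is left orderable, by comparing two automorphisms at the first point,
    in an enumeration of the field, where they differ.

    Cut the line into unit cells.  A local automorphism can be made to act in all
    the cells at once, or in the cells whose index is divisible by [2 ^ j].  A
    "wild" generator acts in the cell of index [n] through the term of index
    [v2 n] of a sequence, placed in an interval that tends to the left end of the
    cell as [v2 n] grows.  Commutators of two wild generators with translates by
    [2 ^ j] isolate the commutator of their [j]-th terms on the cells of index
    [2 ^ j] mod [2 ^ j.+1], so finitely many generators produce any given sequence
    of commutators of local automorphisms.

    Every element of the group commutes, on a left neighbourhood of each point,
    with the translations by [2 ^ j Z] for some [j].  Hence a nontrivial element
    displaces a union of small intervals invariant under [2 ^ j Z], and the
    double commutator trick puts commutators of local automorphisms in its normal
    closure.  The generators other than the wild ones are products of conjugates
    of such commutators, and a wild generator is conjugate to a commutator of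
    itself with one of them.

    Free bits in the sequences are detected by fixed words in the generators.  A
    finitely generated group has countably many generating tuples, so each
    isomorphism class contains countably many members of the family, and a
    diagonal argument gives continuum many classes. *)

From HB Require Import structures.
Require Import Defs.
From mathcomp Require Import all_boot all_order all_algebra.
From mathcomp Require Import ring lra zify.
From mathcomp Require Import boolp classical_sets functions cardinality reals.

Set Implicit Arguments.
Unset Strict Implicit.
Unset Printing Implicit Defensive.

Import Order.TTheory GRing.Theory Num.Theory.

Local Open Scope ring_scope.

(** * Order automorphisms of an ordered field *)

Section Oaut.
Variable F : archiRealFieldType.

(** The inverse is carried as data; being determined by [ofwd], it does not affect equality
    ([oautP]). *)
Record oaut := OAut {
  ofwd :> F -> F;
  obwd : F -> F;
  ofwdK : cancel ofwd obwd;
  obwdK : cancel obwd ofwd;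
  ofwd_lt : {homo ofwd : x y / x < y}}.

Lemma oautP (f g : oaut) : f =1 g -> f = g.
Proof.
case: f g => [f f' fK f'K fm] [g g' gK g'K gm] /= fg.
have {fg} efg : f = g by apply/funext.
subst g; have efg' : f' = g' by apply/funext => x; rewrite -{1}[x]g'K fK.
by subst g'; congr OAut; apply: Prop_irrelevance.
Qed.

Lemma obwd_lt (f : oaut) : {homo obwd f : x y / x < y}.
Proof.
move=> x y xy; rewrite ltNge; apply/negP; rewrite le_eqVlt => /orP[/eqP e|].
  by move: xy; rewrite -[x](obwdK f) -[y](obwdK f) e ltxx.
by move=> /(@ofwd_lt f); rewrite !obwdK => /lt_trans - /(_ _ xy); rewrite ltxx.
Qed.

Definition oaut1 := @OAut id id (fun=> erefl) (fun=> erefl) (fun _ _ h => h).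

Definition oautM (f g : oaut) := @OAut (f \o g) (obwd g \o obwd f)
  (can_comp (ofwdK f) (ofwdK g)) (can_comp (obwdK g) (obwdK f))
  (fun x y h => ofwd_lt f (ofwd_lt g h)).

Definition oautV (f : oaut) := @OAut (obwd f) f (obwdK f) (ofwdK f) (@obwd_lt f).

HB.instance Definition _ := gen_eqMixin oaut.
HB.instance Definition _ := gen_choiceMixin oaut.

Fact oaut_mulA : associative oautM. Proof. by move=> f g h; apply: oautP. Qed.
Fact oaut_mul1 : left_id oaut1 oautM. Proof. by move=> f; apply: oautP. Qed.
Fact oaut_mulr1 : right_id oaut1 oautM. Proof. by move=> f; apply: oautP. Qed.
Fact oaut_mulV : left_inverse oaut1 oautV oautM.
Proof. by move=> f; apply: oautP => x /=; rewrite ofwdK. Qed.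
Fact oaut_mulrV : right_inverse oaut1 oautV oautM.
Proof. by move=> f; apply: oautP => x /=; rewrite obwdK. Qed.

HB.instance Definition _ := isGroup.Build oaut
  oaut_mulA oaut_mul1 oaut_mulr1 oaut_mulV oaut_mulrV.

Lemma oautME (f g : oaut) x : (f * g)%g x = f (g x). Proof. by []. Qed.
Lemma oaut1E x : (1%g : oaut) x = x. Proof. by []. Qed.
Lemma oautVK (f : oaut) x : f ((f^-1)%g x) = x. Proof. exact: obwdK. Qed.
Lemma oautKV (f : oaut) x : (f^-1)%g (f x) = x. Proof. exact: ofwdK. Qed.

Lemma oaut_inj (f : oaut) : injective f. Proof. exact: can_inj (ofwdK f). Qed.

Lemma oaut_le (f : oaut) : {mono f : x y / x <= y}.
Proof. exact/le_mono/ofwd_lt. Qed.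

Lemma oaut_ltE (f : oaut) : {mono f : x y / x < y}.
Proof. exact/leW_mono/oaut_le. Qed.

Lemma oautVP (f : oaut) x y : f x = y -> (f^-1)%g y = x.
Proof. by move=> <-; rewrite oautKV. Qed.

Section Affine.
Variables (a b : F) (a_gt0 : 0 < a).
Fact affK : cancel (fun x => a * x + b) (fun y => (y - b) / a).
Proof. by move=> x; rewrite addrK mulrC mulKf ?gt_eqF. Qed.
Fact affVK : cancel (fun y => (y - b) / a) (fun x => a * x + b).
Proof. by move=> x; rewrite mulrC divfK ?gt_eqF ?subrK. Qed.
Fact aff_lt : {homo (fun x => a * x + b) : x y / x < y}.
Proof. by move=> x y xy; rewrite ltrD2r ltr_pM2l. Qed.
Definition aff := OAut affK affVK aff_lt.
End Affine.

Section Lattice.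
Variables f g : oaut.
(** Inverting a pointwise minimum gives the maximum of the inverses. Piecewise linear automorphisms
    are built below as minima and maxima of affine ones. *)
Fact minK : cancel (fun x => Num.min (f x) (g x)) (fun y => Num.max (obwd f y) (obwd g y)).
Proof.
move=> x; case: (leP (f x) (g x)) => h; rewrite ofwdK.
  by apply/max_idPl; rewrite -(oaut_le g) obwdK.
by apply/max_idPr; rewrite -(oaut_le f) obwdK ltW.
Qed.
Fact minVK : cancel (fun y => Num.max (obwd f y) (obwd g y)) (fun x => Num.min (f x) (g x)).
Proof.
move=> x; case: (leP (obwd f x) (obwd g x)) => h; rewrite obwdK.
  by apply/min_idPr; rewrite -{1}(obwdK f x) oaut_le.
by apply/min_idPl; rewrite -{1}(obwdK g x) oaut_le ltW.
Qed.
Fact min_lt : {homo (fun x => Num.min (f x) (g x)) : x y / x < y}.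
Proof. by move=> x y xy; rewrite lt_min !gt_min !oaut_ltE xy orbT. Qed.
Definition omin := OAut minK minVK min_lt.
End Lattice.

Definition omax (f g : oaut) : oaut := ((omin f^-1 g^-1)^-1)%g.
Lemma omaxE f g x : omax f g x = Num.max (f x) (g x). Proof. by []. Qed.
Lemma ominE f g x : omin f g x = Num.min (f x) (g x). Proof. by []. Qed.

(* An order isomorphism onto [(-1/2, 1/2)], linear on [[-1, 1]] so that piecewise
   linear maps supported there are still piecewise linear inside a cell. *)
Definition sigma (x : F) : F :=
  if `|x| <= 1 then 3 / 8 * x
  else if 0 < x then 1 / 2 - (8 * x)^-1 else - (1 / 2) - (8 * x)^-1.
Definition sigmaV (y : F) : F :=
  if `|y| <= 3 / 8 then 8 / 3 * y
  else if 0 < y then (4 - 8 * y)^-1 else - (4 + 8 * y)^-1.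

Lemma sigma_lin x : -1 <= x <= 1 -> sigma x = 3 / 8 * x.
Proof. by rewrite /sigma ler_norml => ->. Qed.

Lemma sigma_gt x : 1 <= x -> sigma x = 1 / 2 - (8 * x)^-1.
Proof.
rewrite /sigma => x1; case: ifP => [|_]; last by rewrite (lt_le_trans ltr01).
rewrite ler_norml => /andP[_ x1']; have -> : x = 1 by apply/le_anti/andP.
by rewrite !mulr1; field.
Qed.

Lemma sigmaN x : sigma (- x) = - sigma x.
Proof.
rewrite /sigma normrN; case: ifP => [|/negbT]; first by rewrite mulrN.
rewrite -ltNge oppr_gt0 mulrN invrN.
case: (ltgtP x 0) => [x0|x0|->]; rewrite ?normr0 ?ltr10 // => _; lra.
Qed.

Lemma sigma_bnd x : -(1/2) < sigma x < 1/2.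
Proof.
wlog x0 : x / 0 <= x => [hw|].
  case: (leP 0 x) => [/hw//|/ltW x0].
  have := hw (- x); rewrite sigmaN => /(_ _)/wrap[|/andP[h1 h2]]; lra.
have [x1|x1] := leP x 1; first by rewrite sigma_lin; lra.
have h : 0 < (8 * x)^-1 < 1/2; last by rewrite sigma_gt; lra.
have : 0 < 8 * x by lra.
by move=> h; rewrite invr_gt0 h /= invf_plt ?posrE //; lra.
Qed.

Lemma sigmaK : cancel sigma sigmaV.
Proof.
move=> x; rewrite /sigma; case: ifP => [xn|/negbT].
  rewrite /sigmaV normrM; have -> : `|3/8 : F| * `|x| <= 3/8.
    by have -> : `|3/8 : F| = 3/8; [rewrite ger0_norm; lra | lra].
  by field.
rewrite -ltNge; case: (ltgtP x 0) => [x0|x0|->]; rewrite ?normr0 ?ltr10 //.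
  rewrite ltr_normr => /orP[|x1]; first lra.
  have xx : (8 * x)^-1 = - ((8 * - x)^-1) by rewrite mulrN invrN opprK.
  have h : 0 < (8 * - x)^-1 < 1/8.
    have h : 0 < 8 * - x by lra.
    by rewrite invr_gt0 h /= invf_plt ?posrE //; lra.
  rewrite /sigmaV ler_norml; case: ifP => [|_]; first by rewrite xx; lra.
  case: ifP => [|_]; first by rewrite xx; lra.
  rewrite -[RHS]opprK; congr (- _); rewrite -[RHS]invrK; congr (_^-1).
  by field; lra.
rewrite ltr_normr => /orP[x1|]; last lra.
have h : 0 < (8 * x)^-1 < 1/8.
  have h : 0 < 8 * x by lra.
  by rewrite invr_gt0 h /= invf_plt ?posrE //; lra.
rewrite /sigmaV ler_norml; case: ifP => [|_]; first by lra.
case: ifP => [_|]; last by lra.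
by rewrite -[RHS]invrK; congr (_^-1); field; lra.
Qed.

Lemma sigmaVK y : -(1/2) < y < 1/2 -> sigma (sigmaV y) = y.
Proof.
move=> yb; rewrite /sigmaV; case: ifP => [yn|/negbT].
  rewrite sigma_lin; first by field.
  by move: yn; rewrite ler_norml; lra.
rewrite -ltNge ltr_normr; case: ifP => y0 h.
  have k : 0 < 4 - 8 * y < 1 by lra.
  have k1 : 1 <= (4 - 8 * y)^-1 by rewrite invf_ge1; lra.
  by rewrite sigma_gt //; field; lra.
have k : 0 < 4 + 8 * y < 1 by lra.
have k1 : 1 <= (4 + 8 * y)^-1 by rewrite invf_ge1; lra.
by rewrite sigmaN sigma_gt //; field; lra.
Qed.

Lemma sigma_lt : {homo sigma : x y / x < y}.
Proof.
have nonneg_lt x y : 0 <= x -> x < y -> sigma x < sigma y.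
  move=> x0 xy; have [y1|y1] := leP y 1; first by rewrite !sigma_lin; lra.
  have [x1|x1] := leP x 1; last first.
    by rewrite !sigma_gt ?ltW // ltrD2l ltrN2 ltf_pV2 ?posrE; lra.
  have h : 0 < 8 * y by lra.
  have h' : (8 * y)^-1 < 1/8 by rewrite invf_plt ?posrE //; lra.
  by rewrite sigma_lin ?(sigma_gt (ltW y1)); lra.
have s0 : sigma 0 = 0 by rewrite sigma_lin ?mulr0 ?oppr_le0 ?ler01.

move=> x y xy; have [x0|x0] := leP 0 x; first exact: nonneg_lt.
have hx : sigma x < 0.
  by rewrite -[x]opprK sigmaN oppr_lt0 -s0; apply: nonneg_lt; lra.
have [y0|y0] := ltP 0 y; first by rewrite (lt_trans hx) // -s0; apply: nonneg_lt.
by rewrite -[x]opprK -[y]opprK !(sigmaN (- _)) ltrN2; apply: nonneg_lt; lra.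
Qed.

End Oaut.

(** * Acting cell by cell *)

Section Assembly.
Variable F : archiRealFieldType.
Implicit Types (f g : oaut F) (x y : F) (n m : int) (phi psi : int -> oaut F).

Lemma cell_floor n x : n%:~R - 1/2 <= x < n%:~R + 1/2 -> Num.floor (x + 1/2) = n.
Proof. by move=> h; apply: floor_def; rewrite intrD; lra. Qed.

(* The cell of index [n] is the open interval [(n - 1/2, n + 1/2)], with
   coordinate [sigma]; the points [n - 1/2] lie in no cell. *)
Variant cell_spec : F -> Type :=
  | CellHalf n : cell_spec (n%:~R - 1/2)
  | CellIn n y : cell_spec (n%:~R + sigma y).

Lemma cellP x : cell_spec x.
Proof.
pose n := Num.floor (x + 1/2).
have : n%:~R <= x + 1/2 < (n + 1)%:~R by exact: floor_itv.
rewrite intrD => h; have [e|ne] := eqVneq x (n%:~R - 1/2); first by rewrite e; left.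
have -> : x = n%:~R + sigma (sigmaV (x - n%:~R)).
  by rewrite sigmaVK; [rewrite addrC subrK | move/eqP: ne; lra].
exact: CellIn.
Qed.

Definition asmf phi x : F :=
  let n := Num.floor (x + 1/2) in
  if x == n%:~R - 1/2 then x else n%:~R + sigma (phi n (sigmaV (x - n%:~R))).

Lemma asmf_half phi n : asmf phi (n%:~R - 1/2) = n%:~R - 1/2.
Proof. by rewrite /asmf (@cell_floor n) ?eqxx //; lra. Qed.

Lemma asmf_cell phi n y : asmf phi (n%:~R + sigma y) = n%:~R + sigma (phi n y).
Proof.
have sb := sigma_bnd y; rewrite /asmf (@cell_floor n); last by lra.
by rewrite ifN; [rewrite [_ + sigma y]addrC addrK sigmaK | apply/eqP; lra].
Qed.

Lemma asmfK phi psi : (forall n, cancel (phi n) (psi n)) -> cancel (asmf phi) (asmf psi).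
Proof.
move=> h x; case: (cellP x) => [n|n y]; first by rewrite !asmf_half.
by rewrite !asmf_cell h.
Qed.

Lemma intr_ltD1 n m : n < m -> n%:~R + 1 <= m%:~R :> F.
Proof. by move=> h; rewrite -(intrD _ n 1) ler_int; lia. Qed.

Lemma asmf_lt phi : {homo asmf phi : x y / x < y}.
Proof.
move=> x x'; case: (cellP x) => n; case: (cellP x') => n'.
- by rewrite !asmf_half.
- move=> y h; rewrite asmf_half asmf_cell.
  have := sigma_bnd y; have := sigma_bnd (phi n' y).
  case: (leP n n') => [nn|/intr_ltD1]; last lra.
  have : n%:~R <= n'%:~R :> F by rewrite ler_int.
  lra.
- move=> y h; rewrite asmf_half asmf_cell.
  have := sigma_bnd y; have := sigma_bnd (phi n y).
  case: (ltP n n') => [/intr_ltD1|nn]; first lra.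
  have : n'%:~R <= n%:~R :> F by rewrite ler_int.
  lra.
move=> y' y h; rewrite !asmf_cell.
have := sigma_bnd y; have := sigma_bnd (phi n y).
have := sigma_bnd y'; have := sigma_bnd (phi n' y').
case: (ltgtP n n') => [/intr_ltD1|/intr_ltD1|e]; try lra.
move: h; rewrite e !ltrD2l => h _ _ _ _; apply/sigma_lt/ofwd_lt.
by move: h; rewrite (leW_mono (le_mono (@sigma_lt F))).
Qed.

Definition asm phi : oaut F :=
  @OAut F (asmf phi) (asmf (fun n => (phi n)^-1%g))
    (@asmfK phi (fun n => (phi n)^-1%g) (fun n => ofwdK (phi n)))
    (@asmfK (fun n => (phi n)^-1%g) phi (fun n => obwdK (phi n))) (@asmf_lt phi).

Lemma asm_half phi n : asm phi (n%:~R - 1/2) = n%:~R - 1/2.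
Proof. exact: asmf_half. Qed.

Lemma asm_cell phi n y : asm phi (n%:~R + sigma y) = n%:~R + sigma (phi n y).
Proof. exact: asmf_cell. Qed.

Lemma asmM phi psi : (asm phi * asm psi)%g = asm (fun n => (phi n * psi n)%g).
Proof.
apply: oautP => x; rewrite oautME; case: (cellP x) => [n|n y].
  by rewrite !asm_half.
by rewrite !asm_cell.
Qed.

Lemma asm1 : asm (fun=> 1%g) = 1%g.
Proof.
apply: oautP => x; rewrite oaut1E; case: (cellP x) => [n|n y].
  by rewrite !asm_half.
by rewrite !asm_cell.
Qed.

Lemma asmV phi : (asm phi)^-1%g = asm (fun n => (phi n)^-1%g).
Proof. by apply: mulg1_eq; rewrite asmM -asm1; congr asm; apply/funext => n; rewrite mulgV. Qed.

Lemma asmJ phi psi : (asm phi ^ asm psi)%g = asm (fun n => (phi n ^ psi n)%g).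
Proof. by rewrite /conjg asmV !asmM. Qed.

Lemma asmR phi psi : [~ asm phi, asm psi]%g = asm (fun n => [~ phi n, psi n]%g).
Proof. by rewrite /commg asmJ asmV asmM. Qed.

Lemma asm_inj : injective asm.
Proof.
move=> phi psi e; apply/funext => n; apply: oautP => y.
have := congr1 (fun f : oaut F => f (n%:~R + sigma y)) e.
by rewrite !asm_cell => /addrI /(can_inj (@sigmaK F)).
Qed.

Lemma asm_eq1 phi : asm phi = 1%g -> forall n, phi n = 1%g.
Proof. by move=> h n; have /asm_inj -> : asm phi = asm (fun=> 1%g) by rewrite asm1. Qed.

Definition trans (c : F) : oaut F := aff c ltr01.

Lemma transE c x : trans c x = x + c.
Proof. by rewrite /trans /= mul1r. Qed.

Lemma transV c : (trans c)^-1%g = trans (- c).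
Proof. by apply: oautP => x; apply: oautVP; rewrite !transE addrNK. Qed.

Lemma transM c d : (trans c * trans d)%g = trans (c + d).
Proof. by apply: oautP => x; rewrite oautME !transE addrA addrAC. Qed.

(** Since [x ^ y] is [y^-1 * x * y], conjugating by [g^-1] carries supports forward along [g]; hence
    the inverses in conjugations throughout. *)
Lemma asm_trans phi m : (asm phi ^ (trans m%:~R)^-1)%g = asm (fun n => phi (n - m)).
Proof.
apply: oautP => x; rewrite /conjg invgK !oautME transV !transE.
case: (cellP x) => [n|n y].
  by rewrite [n%:~R - _ - _]addrAC -intrB !asm_half intrB addrAC subrK.
by rewrite [n%:~R + _ - _]addrAC -intrB !asm_cell intrB addrAC subrK.
Qed.

(** * Compression into one cell *)

Definition single n f : int -> oaut F := fun k => if k == n then f else 1%g.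

Lemma singleM n f g : (fun k => single n f k * single n g k)%g = single n (f * g)%g.
Proof. by apply/funext => k; rewrite /single; case: eqP => // _; rewrite mulg1. Qed.

(** Conjugation by [sigma], extended by the identity: a copy of the whole group supported in
    [(-1/2, 1/2)]. *)
Definition emb f := asm (single 0 f).

Lemma embM f g : (emb f * emb g)%g = emb (f * g)%g.
Proof. by rewrite /emb asmM singleM. Qed.

Lemma emb1 : emb 1%g = 1%g.
Proof. by rewrite /emb (_ : single 0 1%g = fun=> 1%g) ?asm1//; apply/funext => k; rewrite /single if_same. Qed.

Lemma embV f : (emb f)^-1%g = emb f^-1%g.
Proof. by apply: mulg1_eq; rewrite embM mulgV emb1. Qed.

Lemma embJ f g : (emb f ^ emb g)%g = emb (f ^ g)%g.
Proof. by rewrite /conjg embV !embM. Qed.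

Lemma embR f g : [~ emb f, emb g]%g = emb [~ f, g]%g.
Proof. by rewrite /commg embJ embV embM. Qed.

Lemma emb_eq1 f : emb f = 1%g -> f = 1%g.
Proof. by move=> /asm_eq1 /(_ 0); rewrite /single eqxx. Qed.

Lemma emb_sigma f y : emb f (sigma y) = sigma (f y).
Proof. by have := asm_cell (single 0 f) 0 y; rewrite /single eqxx !add0r. Qed.

Definition fixes_off (a b : F) f := forall x, ~~ (a < x < b) -> f x = x.

Lemma emb_fixes f : fixes_off (-(1/2)) (1/2) (emb f).
Proof.
move=> x; case: (cellP x) => [n|n y] h; first by rewrite /emb asm_half.
have sb := sigma_bnd y; rewrite /emb asm_cell /single; case: eqP => // n0.
by exfalso; move: h; rewrite n0 => /negP []; lra.
Qed.

(* A whole line of cells, compressed into the cell of index [0]. *)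
Definition nest phi := emb (asm phi).

Lemma nestM phi psi : (nest phi * nest psi)%g = nest (fun n => (phi n * psi n)%g).
Proof. by rewrite /nest embM asmM. Qed.
Lemma nestV phi : (nest phi)^-1%g = nest (fun n => (phi n)^-1%g).
Proof. by rewrite /nest embV asmV. Qed.
Lemma nestJ phi psi : (nest phi ^ nest psi)%g = nest (fun n => (phi n ^ psi n)%g).
Proof. by rewrite /nest embJ asmJ. Qed.
Lemma nestR phi psi : [~ nest phi, nest psi]%g = nest (fun n => [~ phi n, psi n]%g).
Proof. by rewrite /nest embR asmR. Qed.
Lemma nest1 : nest (fun=> 1%g) = 1%g.
Proof. by rewrite /nest asm1 emb1. Qed.
Lemma nest_eq1 phi : nest phi = 1%g -> forall n, phi n = 1%g.
Proof. by move=> /emb_eq1 /asm_eq1. Qed.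

(** It moves the inner cells of a [nest] one step to the right. *)
Definition bshift : oaut F := emb (trans 1).

Lemma bshiftX k : (bshift ^+ k)%g = emb (trans k%:R).
Proof.
elim: k => [|k IH]; last by rewrite expgS IH /bshift embM transM -natr1 addrC.
by rewrite expg0 -emb1; congr emb; apply: oautP => x; rewrite transE addr0.
Qed.

Lemma nest_bshift phi (k : nat) : (nest phi ^ (bshift ^+ k)^-1)%g = nest (fun n => phi (n - k%:Z)).
Proof. by rewrite bshiftX embV embJ /nest -asm_trans. Qed.

Lemma nest_bshiftV phi (k : nat) : (nest phi ^ (bshift ^+ k))%g = nest (fun n => phi (n + k%:Z)).
Proof.
have -> : (bshift ^+ k)%g = (emb (trans (- k%:Z)%:~R))^-1%g.
  by rewrite bshiftX embV transV -mulrNz opprK.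
rewrite embV embJ /nest asm_trans.
by congr (emb (asm _)); apply/funext => n; rewrite opprK.
Qed.

(** The set of points moved by an automorphism is invariant under it, so if one factor moves a
    point, the other fixes both the point and its image. *)
Lemma disjoint_commute f g : (forall x, f x = x \/ g x = x) -> commute f g.
Proof.
move=> h; apply: oautP => x; rewrite !oautME.
case: (eqVneq (g x) x) => [gx|/eqP gx].
  case: (eqVneq (f x) x) => [fx|/eqP fx]; first by rewrite gx fx gx.
  by rewrite gx; case: (h (f x)) => // /oaut_inj.
have fx : f x = x by case: (h x).
by rewrite fx; case: (h (g x)) => // /oaut_inj.
Qed.

End Assembly.

Lemma conjgMV (G : groupType) (x y z : G) :
  (x ^ (y * z)^-1 = (x ^ z^-1) ^ y^-1)%g.
Proof. by rewrite invgM conjgM. Qed.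

(** * Ladders *)

Section Tower.
Variable F : archiRealFieldType.
Implicit Types (f g : oaut F) (x y : F) (n m : int) (phi psi : int -> oaut F).

Lemma fixes_offW (a b a' b' : F) f :
  a' <= a -> b <= b' -> fixes_off a b f -> fixes_off a' b' f.
Proof. by move=> ha hb h x /negP xn; apply: h; apply/negP; lra. Qed.

Lemma fixes_offM (a b : F) f g :
  fixes_off a b f -> fixes_off a b g -> fixes_off a b (f * g)%g.
Proof. by move=> hf hg x xn; rewrite oautME hg ?hf. Qed.

Lemma fixes_offV (a b : F) f : fixes_off a b f -> fixes_off a b f^-1%g.
Proof. by move=> hf x xn; apply: oautVP; apply: hf. Qed.

Lemma fixes_off_itv (a b : F) f x : a < b -> fixes_off a b f -> a <= x <= b -> a <= f x <= b.
Proof.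
move=> ab hf xab; have fa : f a = a by apply: hf; rewrite ltxx.
have fb : f b = b by apply: hf; rewrite ltxx andbF.
by case/andP: xab => ax xb; apply/andP; split; [rewrite -fa | rewrite -fb]; rewrite oaut_le.
Qed.

Lemma emb_fixes_above f c :
  (forall y, c <= y -> f y = y) -> forall x, sigma c <= x -> emb f x = x.
Proof.
move=> h x; case: (cellP x) => [n|n y] cx; first by rewrite /emb asm_half.
rewrite /emb asm_cell /single; case: eqP => // n0; rewrite h //.
by move: cx; rewrite n0 add0r (le_mono (@sigma_lt F)).
Qed.

Lemma emb_fixes_below f c :
  (forall y, y <= c -> f y = y) -> forall x, x <= sigma c -> emb f x = x.
Proof.
move=> h x; case: (cellP x) => [n|n y] cx; first by rewrite /emb asm_half.
rewrite /emb asm_cell /single; case: eqP => // n0; rewrite h //.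
by move: cx; rewrite n0 add0r (le_mono (@sigma_lt F)).
Qed.

(** [nest (single 0 f)] is [f] compressed twice, that is, transported by [sigma \o sigma]. Only the
    values of [g] on the support of [f] matter: by monotonicity all other points stay off the image
    of the support. *)
Lemma conj_emb_emb (u v : F) f g : u < v ->
  fixes_off u v f -> (forall x, u <= x <= v -> g x = sigma (sigma x)) ->
  (f ^ g^-1)%g = nest (single 0 f).
Proof.
move=> uv hf hg; apply: oautP => x; rewrite -[x](oautVK g).
move: (g^-1%g x) => {x} y; rewrite /conjg invgK !oautME oautKV.
have gu : g u = sigma (sigma u) by rewrite hg ?lexx ?ltW.
have gv : g v = sigma (sigma v) by rewrite hg ?lexx ?ltW.
case: (boolP (u <= y <= v)) => yuv.
  by rewrite !hg ?(fixes_off_itv uv) // /nest !emb_sigma.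
have fy : f y = y by apply: hf; apply/negP; move/negP: yuv; lra.
rewrite fy; case: (ltP y u) => [yu|uy].
  rewrite (@emb_fixes_below _ (sigma u)) //.
    by apply: emb_fixes_below => z zu; apply: hf; apply/negP; lra.
  by rewrite -gu oaut_le ltW.
rewrite (@emb_fixes_above _ (sigma v)) //.
  by apply: emb_fixes_above => z zu; apply: hf; apply/negP; lra.
by rewrite -gv oaut_le; lra.
Qed.

Lemma sigma2_lin x : -1 <= x <= 1 -> sigma (sigma x) = 9 / 64 * x.
Proof. by move=> x1; rewrite (sigma_lin x1) sigma_lin; lra. Qed.

Definition pivot (l : F) (l0 : 0 < l) (m : F) : oaut F := aff (m - l * m) l0.

Lemma pivotE l l0 (m : F) x : @pivot l l0 m x = m + l * (x - m).
Proof. by rewrite /pivot /=; ring. Qed.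

(** For [l <= 1 <= M] and [m < v], the graph leaves the diagonal at [m] with slope [l] and returns
    to it at [v] with slope [M]. *)
Definition squeeze_right (l M : F) (l0 : 0 < l) (M0 : 0 < M) (m v : F) : oaut F :=
  omin 1%g (omax (pivot l0 m) (pivot M0 v)).
Definition squeeze_left (l M : F) (l0 : 0 < l) (M0 : 0 < M) (m v : F) : oaut F :=
  omax 1%g (omin (pivot l0 m) (pivot M0 v)).

Lemma squeeze_rightE (l M : F) (l0 : 0 < l) (M0 : 0 < M) (m v x : F) :
  squeeze_right l0 M0 m v x = Num.min x (Num.max (m + l * (x - m)) (v + M * (x - v))).
Proof. by rewrite /squeeze_right ominE omaxE !pivotE. Qed.

Lemma squeeze_leftE (l M : F) (l0 : 0 < l) (M0 : 0 < M) (m v x : F) :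
  squeeze_left l0 M0 m v x = Num.max x (Num.min (m + l * (x - m)) (v + M * (x - v))).
Proof. by rewrite /squeeze_left omaxE ominE !pivotE. Qed.

Lemma squeeze_right_fixes (l M : F) (l0 : 0 < l) (M0 : 0 < M) (m v : F) :
  l <= 1 -> 1 <= M -> fixes_off m v (squeeze_right l0 M0 m v).
Proof.
move=> l1 M1 x xmv; rewrite squeeze_rightE; apply/min_idPl; rewrite le_max.
case: (leP x m) => xm.
  apply/orP; left; have := mulr_ge0 (_ : 0 <= 1 - l) (_ : 0 <= m - x); rewrite !subr_ge0 => /(_ l1 xm); lra.
have vx : v <= x by rewrite leNgt; move: xmv; rewrite xm.
apply/orP; right.
have := mulr_ge0 (_ : 0 <= M - 1) (_ : 0 <= x - v); rewrite !subr_ge0 => /(_ M1 vx); lra.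
Qed.

Lemma squeeze_left_fixes (l M : F) (l0 : 0 < l) (M0 : 0 < M) (m v : F) :
  l <= 1 -> 1 <= M -> fixes_off v m (squeeze_left l0 M0 m v).
Proof.
move=> l1 M1 x xmv; rewrite squeeze_leftE; apply/max_idPl; rewrite ge_min.
case: (leP m x) => xm.
  apply/orP; left; have := mulr_ge0 (_ : 0 <= 1 - l) (_ : 0 <= x - m); rewrite !subr_ge0 => /(_ l1 xm); lra.
have vx : x <= v by rewrite leNgt; move: xmv; rewrite xm andbT.
apply/orP; right.
have := mulr_ge0 (_ : 0 <= M - 1) (_ : 0 <= v - x); rewrite !subr_ge0 => /(_ M1 vx); lra.
Qed.

(** [9 / 64] is the slope of [sigma \o sigma] on [[-1, 1]]. The line of slope [3 / 2] through
    [(3, 3)] vanishes at [1], so on [[0, 1]] the inner slope prevails. *)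
Fact shrink_slope_gt0 : 0 < 9 / 64 :> F. Proof. lra. Qed.
Fact shrink_outer_slope_gt0 : 0 < 3 / 2 :> F. Proof. lra. Qed.
Definition shrink_right : oaut F := squeeze_right shrink_slope_gt0 shrink_outer_slope_gt0 0 3.
Definition shrink_left : oaut F := squeeze_left shrink_slope_gt0 shrink_outer_slope_gt0 0 (-3).
Definition shrink : oaut F := (shrink_left * shrink_right)%g.

Lemma shrinkE x : -1 <= x <= 1 -> shrink x = sigma (sigma x).
Proof.
move=> x1; rewrite sigma2_lin // /shrink oautME.
case: (lerP 0 x) => x0.
  have -> : shrink_right x = 9 / 64 * x.
    rewrite squeeze_rightE subr0 add0r.
    by rewrite (max_idPl _) ?(min_idPr _) //; lra.
  rewrite squeeze_leftE subr0 add0r opprK; apply/max_idPl.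
  by rewrite ge_min; apply/orP; left; lra.
rewrite squeeze_right_fixes; [|lra|lra|by rewrite ltNge (ltW x0)].
rewrite squeeze_leftE subr0 add0r opprK.
by rewrite (min_idPl _) ?(max_idPr _) //; lra.
Qed.

Lemma shrink_conj f : fixes_off (-1) 1 f -> (f ^ shrink^-1)%g = nest (single 0 f).
Proof. by move=> h; apply: (conj_emb_emb _ h shrinkE); lra. Qed.

Lemma nest_fixes phi : fixes_off (-1) 1 (nest phi).
Proof. by apply: fixes_offW (emb_fixes _); lra. Qed.

(* [ray f] and its translate by one cell differ by one copy of [f]; iterating,
   rung [l.+1] of [ladder f] has rung [l] as a commutator.  This makes [ladder f]
   conjugate to a commutator of itself ([ladder_rel]). *)
Definition on_nonneg f : int -> oaut F := fun n => if 0 <= n then f else 1%g.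
Definition ray f := nest (on_nonneg f).
Definition rung l f := iter l ray f.
Definition ladder f := nest (fun n => if n is Posz l then rung l f else 1%g).

Lemma rung_fixes l f : fixes_off (-1) 1 f -> fixes_off (-1) 1 (rung l f).
Proof. by case: l => // l _; apply: nest_fixes. Qed.

Lemma rayM f g : (ray f * ray g)%g = ray (f * g)%g.
Proof. by rewrite /ray nestM; congr nest; apply/funext => n; rewrite /on_nonneg; case: ifP => // _; rewrite mulg1. Qed.

Lemma rungM l f g : (rung l f * rung l g)%g = rung l (f * g)%g.
Proof. by elim: l => //= l IH; rewrite rayM IH. Qed.

Lemma ladderM f g : (ladder f * ladder g)%g = ladder (f * g)%g.
Proof. by rewrite /ladder nestM; congr nest; apply/funext => -[l|l]; rewrite ?rungM ?mulg1. Qed.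

Lemma ladder1 : ladder 1%g = 1%g.
Proof. by apply: (@mulgI _ (ladder 1%g)); rewrite ladderM !mulg1. Qed.

Lemma ladderV f : (ladder f)^-1%g = ladder f^-1%g.
Proof. by apply: mulg1_eq; rewrite ladderM mulgV ladder1. Qed.

Lemma ladderR f g : [~ ladder f, ladder g]%g = ladder [~ f, g]%g.
Proof. by rewrite /commg /conjg !ladderV !ladderM. Qed.

Lemma ladder_eq1 f : ladder f = 1%g -> f = 1%g.
Proof. by move=> /nest_eq1 /(_ 0). Qed.

Local Notation bshift := (bshift F).

Lemma nest_bshift1 phi : (nest phi ^ bshift^-1)%g = nest (fun n => phi (n - 1)).
Proof. by have := nest_bshift phi 1; rewrite expg1. Qed.

Lemma ray_bshift f : (ray f * (ray f ^ bshift^-1)^-1)%g = nest (single 0 f).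
Proof.
rewrite nest_bshift1 nestV nestM; congr nest.
apply/funext => -[[|n]|n]; rewrite /on_nonneg /single //=.
- by rewrite invg1 mulg1.
- by rewrite mulgV.
by rewrite mulgV.
Qed.

Definition upper_shift : oaut F := nest (fun n => if n is Posz l.+1 then bshift else 1%g).
Definition ladder_lift : oaut F := (bshift * nest (fun=> shrink))%g.
Definition second_shift : oaut F := nest (single 1 bshift).

(** Both sides carry [rung l f], compressed twice, in the inner cell [l.+1], and nothing in the
    inner cells up to [0]: on the left as the quotient of a ray by its translate, on the right by
    [shrink_conj]. *)
Lemma ladder_rel f : fixes_off (-1) 1 f ->
  (ladder f * (ladder f ^ upper_shift^-1)^-1)%g = (ladder f ^ ladder_lift^-1)%g.
Proof.
move=> hf; rewrite /ladder_lift conjgMV /ladder /upper_shift.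
rewrite (nestV (fun=> shrink)) nestJ nest_bshift1.
rewrite !nestV nestJ nestV nestM; congr nest; apply/funext => -[[|l]|l] /=.
- by rewrite invg1 conjg1 mulgV conj1g.
- rewrite ray_bshift -shrink_conj; last exact: rung_fixes.
  by rewrite subn1.
by rewrite !conj1g divgg.
Qed.

(** [second_shift] acts in the inner cell [1] only, so the quotient keeps one twice compressed copy
    of [f] there. [bshift] brings it to the inner cell [0], and each [shrink] undoes a double
    compression. *)
Lemma ladder_extract f : fixes_off (-1) 1 f ->
  ((((ladder f * (ladder f ^ second_shift^-1)^-1) ^ bshift) ^ shrink) ^ shrink)%g = f.
Proof.
move=> hf.
rewrite /ladder /second_shift nestV nestJ nestV nestM.
set X := nest _; have -> : X = nest (single 1 (f ^ shrink^-1)%g); rewrite {}/X.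
  congr nest; apply/funext => -[[|[|l]]|l]; rewrite /single /=.
  - by rewrite invg1 conjg1 mulgV.
  - by rewrite ray_bshift shrink_conj.
  - by rewrite invg1 conjg1 mulgV.
  by rewrite invg1 conjg1 mulgV.
have -> : nest (single 1 (f ^ shrink^-1)%g) = (nest (single 0 (f ^ shrink^-1)%g) ^ bshift^-1)%g.
  rewrite nest_bshift1; congr nest; apply/funext => n.
  by rewrite /single subr_eq0.
rewrite conjgKV -shrink_conj; last first.
  by rewrite shrink_conj //; apply: nest_fixes.
by rewrite !conjgKV.
Qed.

End Tower.

(** * Isolating the terms of a wild automorphism *)

Definition pow2 (j : nat) : int := (2 ^ j)%N%:Z.
Definition v2 (n : int) : nat := logn 2 `|n|.
(** Unlike [j <= v2 n], this is correct at [n = 0], where [logn] returns [0]. *)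
Definition dvd2 (j : nat) (n : int) : bool := (2 ^ j %| `|n|)%N.

Lemma dvd2P j n : reflect (exists q, n = q * pow2 j) (dvd2 j n).
Proof.
rewrite /dvd2 -[X in (X %| _)%N]/(`|pow2 j|%N) -dvdzE; exact: dvdzP.
Qed.

Lemma dvd2_v2 j n : n != 0 -> dvd2 j n = (j <= v2 n)%N.
Proof. by move=> n0; rewrite /dvd2 /v2 pfactor_dvdn // absz_gt0. Qed.

Lemma pow2S j : pow2 j.+1 = 2 * pow2 j.
Proof. by rewrite /pow2 expnS PoszM. Qed.

Lemma pow2_gt0 j : 0 < pow2 j.
Proof. by rewrite /pow2 ltz_nat expn_gt0. Qed.

Lemma dvd2D j n m : dvd2 j n -> dvd2 j m -> dvd2 j (n + m).
Proof. by move=> /dvd2P[q ->] /dvd2P[p ->]; apply/dvd2P; exists (q + p); rewrite mulrDl. Qed.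

Lemma dvd2N j n : dvd2 j (- n) = dvd2 j n.
Proof. by rewrite /dvd2 abszN. Qed.

Lemma dvd2B j n m : dvd2 j n -> dvd2 j m -> dvd2 j (n - m).
Proof. by move=> hn hm; apply: dvd2D; rewrite ?dvd2N. Qed.

Lemma dvd2W i j n : (i <= j)%N -> dvd2 j n -> dvd2 i n.
Proof. by move=> ij; apply: dvdn_trans; rewrite dvdn_exp2l. Qed.

Lemma dvd2_pow2 i j : dvd2 i (pow2 j) = (i <= j)%N.
Proof. by rewrite /dvd2 /pow2 /= dvdn_Pexp2l. Qed.

Lemma dvd2_0 j : dvd2 j 0. Proof. by rewrite /dvd2 dvdn0. Qed.

Lemma dvd2_half j n : dvd2 j n -> dvd2 j.+1 n (+) dvd2 j.+1 (n - pow2 j).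
Proof.
move=> /dvd2P[q ->].
have q2 : q = ((q %/ 2)%Z * 2 + (q %% 2)%Z) by exact: divz_eq.
have : (q %% 2)%Z = 0 \/ (q %% 2)%Z = 1 by lia.
have nd1 : dvd2 j.+1 (pow2 j) = false by rewrite dvd2_pow2 ltnn.
have d2 k : dvd2 j.+1 (k * 2 * pow2 j).
  by apply/dvd2P; exists k; rewrite pow2S mulrA.
case=> e; rewrite e in q2; rewrite q2 ?addr0 ?mulrDl ?mul1r ?addrK d2.
  suff -> : dvd2 j.+1 ((q %/ 2)%Z * 2 * pow2 j - pow2 j) = false by [].
  apply/negP => h; move/negP: nd1 => []; rewrite -dvd2N.
  by have := dvd2B h (d2 (q %/ 2)%Z); rewrite addrAC subrr add0r.
suff -> : dvd2 j.+1 ((q %/ 2)%Z * 2 * pow2 j + pow2 j) = false by [].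
apply/negP => h; move/negP: nd1 => [].
by have := dvd2B h (d2 (q %/ 2)%Z); rewrite addrAC subrr add0r.
Qed.

Lemma v2_eq j n : n != 0 -> (v2 n == j) = dvd2 j n && ~~ dvd2 j.+1 n.
Proof. by move=> n0; rewrite !dvd2_v2 // -leqNgt eqn_leq andbC. Qed.

Lemma v2_shift_lt j n m : n != 0 -> (v2 n < j)%N -> dvd2 j m -> n + m != 0 /\ v2 (n + m) = v2 n.
Proof.
move=> n0 nj jm; have := v2_eq (v2 n) n0; rewrite eqxx => /esym /andP[h1 h2].
have h3 : dvd2 (v2 n) (n + m) by rewrite dvd2D // (dvd2W (ltnW nj)).
have h4 : ~~ dvd2 (v2 n).+1 (n + m).
  apply/negP => /dvd2B /(_ (dvd2W nj jm)); rewrite addrK; exact/negP.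
have h0 : n + m != 0 by apply: contraNneq h4 => ->; exact: dvd2_0.
by split=> //; apply/eqP; rewrite v2_eq // h3.
Qed.

(** Exactly one of [n] and [n - 2 ^ j] is divisible by [2 ^ j.+1]. *)
Lemma v2_shift_ge j n : n != 0 -> n - pow2 j != 0 -> (j <= v2 n)%N ->
  v2 (n - pow2 j) <> v2 n.
Proof.
move=> n0 m0 jn e.
have dj : dvd2 j n by rewrite dvd2_v2.
have := dvd2_half dj; rewrite !dvd2_v2 // e.
by case: (_ <= _)%N.
Qed.

Lemma v2_dvd2 j n : (n != 0) && (v2 n == j) = dvd2 j.+1 (n - pow2 j).
Proof.
have [->|n0] /= := eqVneq n 0.
  by rewrite sub0r dvd2N dvd2_pow2 ltnn.
rewrite v2_eq //; case: (boolP (dvd2 j n)) => /= [/dvd2_half|/negP nd].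
  by case: (dvd2 j.+1 n); case: (dvd2 _ _).
apply/esym/negP => h; apply: nd.
have := dvd2D (dvd2W (leqnSn j) h) (_ : dvd2 j (pow2 j)).
by rewrite dvd2_pow2 subrK; apply.
Qed.

(** * Wild automorphisms and the extraction of their terms *)

Section Wild.
Variable F : archiRealFieldType.
Implicit Types (f g z : oaut F) (x y : F) (n m : int) (a b : nat -> oaut F).

Local Notation bshift := (bshift F).
Local Notation shrink := (shrink F).
Local Notation second_shift := (second_shift F).

Record subgrp (S : oaut F -> Prop) : Prop := Subgrp {
  subgrp1 : S 1%g;
  subgrpM : forall f g, S f -> S g -> S (f * g)%g;
  subgrpV : forall f, S f -> S f^-1%g }.

Lemma subgrpJ S f g : subgrp S -> S f -> S g -> S (f ^ g)%g.
Proof. by move=> hS hf hg; rewrite /conjg; do !apply: subgrpM => //; apply: subgrpV. Qed.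

Lemma subgrpR S f g : subgrp S -> S f -> S g -> S [~ f, g]%g.
Proof. by move=> hS hf hg; rewrite /commg; apply: subgrpM; [|apply: subgrpV|apply: subgrpJ]. Qed.

Lemma subgrpX S f k : subgrp S -> S f -> S (f ^+ k)%g.
Proof.
move=> hS hf; elim: k => [|k IH]; first by rewrite expg0; apply: subgrp1.
by rewrite expgS; apply: subgrpM.
Qed.

Definition diag f : oaut F := asm (fun=> f).
Definition on (C : int -> bool) f : oaut F := asm (fun n => if C n then f else 1%g).

Lemma onM C f g : (on C f * on C g)%g = on C (f * g)%g.
Proof. by rewrite /on asmM; congr asm; apply/funext => n; case: ifP => // _; rewrite mulg1. Qed.
Lemma on1 C : on C 1%g = 1%g.
Proof. by apply: (@mulgI _ (on C 1%g)); rewrite onM !mulg1. Qed.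
Lemma onV C f : (on C f)^-1%g = on C f^-1%g.
Proof. by apply: mulg1_eq; rewrite onM mulgV on1. Qed.
Lemma onJ C f g : (on C f ^ on C g)%g = on C (f ^ g)%g.
Proof. by rewrite /conjg onV !onM. Qed.
Lemma onR C f g : [~ on C f, on C g]%g = on C [~ f, g]%g.
Proof. by rewrite /commg onJ onV onM. Qed.
Lemma on_diagJ C f g : (on C f ^ diag g)%g = on C (f ^ g)%g.
Proof. by rewrite asmJ; congr asm; apply/funext => n; case: ifP => // _; rewrite conj1g. Qed.
Lemma asm_diagJV phi g : (asm phi ^ (diag g)^-1)%g = asm (fun n => (phi n ^ g^-1)%g).
Proof. by rewrite /diag asmV asmJ. Qed.
Lemma on_trans C f m : (on C f ^ (trans m%:~R)^-1)%g = on (fun n => C (n - m)) f.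
Proof. by rewrite /on asm_trans. Qed.
Lemma on_diag f : on (dvd2 0) f = diag f.
Proof. by rewrite /on /diag; congr asm; apply/funext => n; rewrite /dvd2 dvd1n. Qed.
Lemma diagM f g : (diag f * diag g)%g = diag (f * g)%g. Proof. by rewrite -!on_diag onM. Qed.
Lemma diagV f : (diag f)^-1%g = diag f^-1%g. Proof. by rewrite -!on_diag onV. Qed.

(** Used to descend from the multiples of [2 ^ j.+1] to those of [2 ^ j], and finally to all
    cells. *)
Lemma on_split j f : on (dvd2 j) f =
  (on (dvd2 j.+1) f * (on (dvd2 j.+1) f ^ (trans (pow2 j)%:~R)^-1))%g.
Proof.
rewrite on_trans /on asmM; congr asm; apply/funext => n.
case: (boolP (dvd2 j n)) => [/dvd2_half|nd].
  by case: (dvd2 j.+1 n); case: (dvd2 _ _) => //= _; rewrite ?mulg1 ?mul1g.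
rewrite !ifN ?mulg1 //; apply: contra nd => h.
  have := dvd2D (dvd2W (leqnSn j) h) (_ : dvd2 j (pow2 j)).
  by rewrite dvd2_pow2 subrK; apply.
exact: dvd2W h.
Qed.

(** The support lies in the inner cell of index [- i]; these tend to the left end of the cell as [i]
    grows. *)
Definition place (i : nat) f : oaut F := (nest (single 0 f) ^ (bshift ^+ i))%g.

Lemma placeE i f : place i f = nest (single (- i%:Z) f).
Proof.
rewrite /place nest_bshiftV; congr nest; apply/funext => n.
by rewrite /single -subr_eq0 -[RHS]/(if n == - i%:Z then f else 1%g) -(subr_eq0 n) subr0 opprK.
Qed.

Lemma placeM i f g : (place i f * place i g)%g = place i (f * g)%g.
Proof. by rewrite !placeE nestM singleM. Qed.
Lemma place1 i : place i 1%g = 1%g.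
Proof. by apply: (@mulgI _ (place i 1%g)); rewrite placeM !mulg1. Qed.
Lemma placeV i f : (place i f)^-1%g = place i f^-1%g.
Proof. by apply: mulg1_eq; rewrite placeM mulgV place1. Qed.
Lemma placeR i f g : [~ place i f, place i g]%g = place i [~ f, g]%g.
Proof. by rewrite /commg /conjg !placeV !placeM. Qed.
Lemma place_disj i j f g : i <> j -> [~ place i f, place j g]%g = 1%g.
Proof.
move=> ij; rewrite !placeE nestR -nest1; congr nest; apply/funext => n.
rewrite /single; case: eqP => [->|_]; last by rewrite comm1g.
by rewrite ifN ?commg1 //; apply/eqP; lia.
Qed.
Lemma place_eq1 i f : place i f = 1%g -> f = 1%g.
Proof. by rewrite placeE => /nest_eq1 /(_ (- i%:Z)); rewrite /single eqxx. Qed.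

Lemma place_nestJ i f phi g : phi = (fun=> g) -> (place i f ^ nest phi)%g = place i (f ^ g)%g.
Proof.
move=> ->; rewrite !placeE nestJ; congr nest; apply/funext => n.
by rewrite /single; case: ifP => // _; rewrite conj1g.
Qed.

(* The junk value [v2 0 = 0] forces the separate case of the cell [0], where the
   limit of the places is the identity. *)
Definition wild (a : nat -> oaut F) : oaut F :=
  asm (fun n => if n == 0 then 1%g else place (v2 n) (ladder (a (v2 n)))).

Definition diag_upper_shift : oaut F := diag (nest (fun=> upper_shift F)).
Definition diag_ladder_lift : oaut F := diag (nest (fun=> ladder_lift F)).

(** [ladder_rel] holds in all the cells at once, because the conjugating automorphisms act alike in
    every place. It serves to put a wild generator in a normal subgroup that contains
    [diag_upper_shift]. *)
Lemma wild_rel a : (forall i, fixes_off (-1) 1 (a i)) ->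
  (wild a * (wild a ^ diag_upper_shift^-1)^-1)%g = (wild a ^ diag_ladder_lift^-1)%g.
Proof.
move=> ha; rewrite /wild /diag_upper_shift /diag_ladder_lift !asm_diagJV asmV asmM.
congr asm; apply/funext => n /=; case: ifP => _; first by rewrite !conj1g mulgV.
rewrite (nestV (fun=> upper_shift F)) (nestV (fun=> ladder_lift F)) !(place_nestJ _ _ erefl) placeV placeM; congr place.
exact: ladder_rel.
Qed.

Definition isolate a b (j : nat) : oaut F :=
  [~ wild a, wild b ^ (trans (pow2 j)%:~R)^-1]%g.

(* For [2 ^ j] dividing [n], the 2-adic valuations of [n] and [n - 2 ^ j] differ,
   so the two wild automorphisms act on disjoint places of the cell [n]. *)
Lemma isolateE a b j : isolate a b j = asm (fun n =>
  if (n != 0) && (v2 n < j)%N then place (v2 n) (ladder [~ a (v2 n), b (v2 n)]%g)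
  else 1%g).
Proof.
rewrite /isolate asm_trans asmR; congr asm; apply/funext => n.
have [->|n0] /= := eqVneq n 0; first by rewrite comm1g.
case: ltnP => nj.
  have [m0 e] : n + - pow2 j != 0 /\ v2 (n + - pow2 j) = v2 n.
    by apply: v2_shift_lt nj _; rewrite // dvd2N dvd2_pow2.
  by rewrite (negbTE m0) e placeR ladderR.
case: eqP => [|/eqP m0]; first by rewrite commg1.
by apply: place_disj => /esym; apply: v2_shift_ge.
Qed.

(** [isolate a b j] lives on the valuations below [j], so two consecutive ones differ on the cells
    of valuation exactly [j], which are those of index [2 ^ j] modulo [2 ^ j.+1]. *)
Lemma isolate_single a b j : ((isolate a b j)^-1 * isolate a b j.+1)%g =
  (on (dvd2 j.+1) (place j (ladder [~ a j, b j])) ^ (trans (pow2 j)%:~R)^-1)%g.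
Proof.
rewrite on_trans !isolateE asmV asmM; congr asm; apply/funext => n.
rewrite -v2_dvd2; case: eqP => //= _; first by rewrite invg1 mulg1.
rewrite ltnS; case: ltngtP => [||->]; rewrite ?mulVg ?invg1 ?mulg1 //.
by rewrite mul1g.
Qed.

Lemma isolate_eq1 a b j : ((isolate a b j)^-1 * isolate a b j.+1)%g = 1%g <-> [~ a j, b j]%g = 1%g.
Proof.
rewrite isolate_single; split=> [|->]; last first.
  by rewrite ladder1 place1 on1 conj1g.
move/eqP; rewrite conjg_eq1 => /eqP /asm_eq1 /(_ 0); rewrite dvd2_0.
by move=> /place_eq1 /ladder_eq1.
Qed.

(** The isolated ladder is translated onto the multiples of [2 ^ j.+1], moved to the inner cell [0],
    decompressed, and reduced to its bottom rung by [ladder_extract]. [on_split] then reaches every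
    coarser class. *)
Lemma on_commg (S : oaut F -> Prop) a b j i : subgrp S ->
  (forall m, S (trans m%:~R)) -> S (diag bshift) -> S (diag shrink) -> S (diag second_shift) ->
  S (wild a) -> S (wild b) ->
  fixes_off (-1) 1 (a j) -> fixes_off (-1) 1 (b j) -> (i <= j.+1)%N ->
  S (on (dvd2 i) [~ a j, b j]%g).
Proof.
move=> hS St Ss Sr So Sa Sb haj hbj.
have SJ f g : S f -> S g -> S (f ^ g)%g by apply: subgrpJ.
have SV f : S f -> S f^-1%g by apply: subgrpV.
have Si k : S (isolate a b k) by apply: subgrpR => //; apply: SJ => //; apply: SV.
have hz : fixes_off (-1) 1 [~ a j, b j]%g.
  by rewrite /commg /conjg; do !(apply: fixes_offM || apply: fixes_offV || assumption).
have : S (on (dvd2 j.+1) [~ a j, b j]%g).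
  have : S ((isolate a b j)^-1 * isolate a b j.+1)%g by apply: subgrpM => //; apply: SV.
  rewrite isolate_single => /SJ /(_ (St (pow2 j))); rewrite conjgKV.
  move: (dvd2 j.+1) => C.
  move=> /SJ /(_ (SV _ (subgrpX j hS Ss))).
  have -> : (diag bshift ^+ j)%g = diag (bshift ^+ j)%g.
    elim: j {haj hbj hz} => [|k IH]; first by rewrite !expg0 /diag asm1.
    by rewrite !expgS IH diagM.
  rewrite diagV on_diagJ conjgK -shrink_conj; last exact: nest_fixes.
  move=> /SJ /(_ Sr); rewrite on_diagJ conjgKV => h.
  rewrite -[X in on C X](ladder_extract hz) -!on_diagJ -onM -onV -on_diagJ -diagV.
  do 3![apply: (SJ) => //]; apply: subgrpM => //; apply: (SV); apply: (SJ) => //.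
  exact: SV.
move: (j.+1) => k {haj hbj}; elim: k => [|k IH] h; first by rewrite leqn0 => /eqP ->.
rewrite leq_eqVlt => /orP[/eqP -> //|]; apply: IH.
by rewrite on_split; apply: subgrpM => //; apply: SJ => //; apply: SV.
Qed.

End Wild.

(** * Left periodicity and normal subgroups *)

Section Dynamics.
Variable F : archiRealFieldType.
Implicit Types (f g w : oaut F) (x y z : F) (n m : int) (a b : nat -> oaut F).

Local Notation bshift := (bshift F).
Local Notation shrink := (shrink F).
Local Notation second_shift := (second_shift F).

(* Left neighbourhoods are used because the places of a wild automorphism
   accumulate at the left end of each cell, from the right. *)
Definition left_periodic f := forall x, exists2 y, y < x &
  exists j, forall z, y < z <= x -> forall m, dvd2 j m -> f (z + m%:~R) = f z + m%:~R.

Lemma left_periodic_subgrp : subgrp left_periodic.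
Proof.
split=> [x|f g hf hg x|f hf x].
- by exists (x - 1); [lra | exists 0%N].
- have [y yx [j hj]] := hg x; have [y' y'x [j' hj']] := hf (g x).
  exists (Num.max y (g^-1%g y')).
    by rewrite gt_max yx -(oaut_ltE g) oautVK.
  exists (maxn j j') => z /andP[]; rewrite gt_max => /andP[yz y'z zx] m hm.
  rewrite !oautME hj ?yz ?zx //; last by apply: dvd2W hm; rewrite leq_maxl.
  rewrite hj' ?oaut_le ?zx ?andbT //; last by apply: dvd2W hm; rewrite leq_maxr.
  by rewrite -(oautVK g y') oaut_ltE.
have [y yx [j hj]] := hf (f^-1%g x).
exists (f y); first by rewrite -[x](oautVK f) oaut_ltE.
exists j => z /andP[yz zx] m hm; apply: oautVP; rewrite hj ?oautVK // ?oaut_le ?zx ?andbT.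
by rewrite -(oaut_ltE f) oautVK.
Qed.

Lemma left_periodic_trans (c : F) : left_periodic (trans c).
Proof.
by move=> x; exists (x - 1); [lra | exists 0%N => z _ m _]; rewrite !transE addrAC.
Qed.

Lemma cell_addr n m x : n%:~R + x + m%:~R = (n + m)%:~R + x :> F.
Proof. by rewrite intrD addrAC. Qed.

Lemma left_periodic_diag f : left_periodic (diag f).
Proof.
move=> x; exists (x - 1); first lra.
exists 0%N => z _ m _; rewrite /diag; case: (cellP z) => [n|n y].
  by rewrite cell_addr !asm_half cell_addr.
by rewrite cell_addr !asm_cell cell_addr.
Qed.

Lemma place_fixes_above i f (c : F) : - i%:R + 1/2 <= c ->
  forall y, sigma c <= y -> place i f y = y.
Proof.
move=> ic; rewrite placeE; apply: emb_fixes_above => y cy.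
case: (cellP y) cy => [n|n z] cy; first by rewrite asm_half.
rewrite asm_cell /single; case: eqP => // ni.
by exfalso; move: cy ic; rewrite ni mulrNz; have := sigma_bnd z; lra.
Qed.

(** The places accumulate only at [-1/2], and from the right. *)
Lemma place_vanish x : exists2 y, y < x & exists j, forall i f z,
  (j <= i)%N -> y < z <= x -> place i f z = z.
Proof.
have [x0|x0] := leP x (- (1/2)).
  exists (x - 1); first lra.
  exists 0%N => i f z _ zx; rewrite placeE; apply: emb_fixes.
  by apply/negP; lra.
(* The midpoint of [-1/2] and [Num.min x (1/2)]; all places of large index lie to its left. *)
pose y := - (1/4) + (Num.min x (1/2)) / 2.
have yb : - (1/2) < y < 1/2 /\ y < x.
  by rewrite /y; case: (leP x (1/2)) => ?; split; lra.
exists y; first by case: yb.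
have w0 : 0 <= `|sigmaV y| by [].
exists (Num.bound `|sigmaV y|).+1 => i f z ji /andP[yz _].
apply: (@place_fixes_above _ _ (sigmaV y)); last by rewrite sigmaVK ?ltW //; case: yb.
have := archi_boundP w0; set k := Num.bound _ => hk.
have : k.+1%:R <= i%:R :> F by rewrite ler_nat.
rewrite -natr1; have := ler_norm (- sigmaV y); rewrite normrN; lra.
Qed.

(** Covers the right end of a cell, which is not a value of [sigma]. *)
Lemma place_vanish_above : exists c : F, exists j, forall i f z,
  (j <= i)%N -> c < z -> place i f z = z.
Proof.
exists 0, 1%N => i f z i1 z0; apply: (@place_fixes_above _ _ 0).
  have : 1%:R <= i%:R :> F by rewrite ler_nat.
  lra.
by rewrite sigma_lin; lra.
Qed.

(** In a cell [n != 0], translations by multiples of [2 ^ (v2 n).+1] preserve the valuation. The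
    cell [0] is fixed pointwise, and a nonzero translation by a multiple of [2 ^ j] leads from it to
    a place of index at least [j], which is trivial on the chosen left neighbourhood. *)
Lemma left_periodic_wild a : left_periodic (wild a).
Proof.
(* Each point is treated in the cell on its left, closed at the right end. *)
suff main n x : n%:~R - 1/2 < x <= n%:~R + 1/2 -> exists2 y, y < x &
    exists j, forall z, y < z <= x -> forall m, dvd2 j m ->
    wild a (z + m%:~R) = wild a z + m%:~R.
  move=> x; case: (cellP x) => [n|n y].
    by apply: (main (n - 1)); rewrite intrB; lra.
  by apply: (main n); have := sigma_bnd y; lra.
have half k : k%:~R + 1/2 = (k + 1)%:~R - 1/2 :> F by rewrite intrD; field.
have pt z : n%:~R - 1/2 < z <= n%:~R + 1/2 ->
    z = (n + 1)%:~R - 1/2 \/ exists u, z = n%:~R + sigma u.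
  move=> zn; have [e|ne] := eqVneq z (n%:~R + 1/2); first by left; rewrite e half.
  right; exists (sigmaV (z - n%:~R)).
  by rewrite sigmaVK; [rewrite addrC subrK | move/eqP: ne; lra].
move=> xn; have [n0|n0] := eqVneq n 0; last first.
  exists (n%:~R - 1/2); first by case/andP: xn.
  exists (v2 n).+1 => z zx m hm.
  have [->|[u ->]] : z = (n + 1)%:~R - 1/2 \/ exists u, z = n%:~R + sigma u.
    by apply: pt; lra.
    by rewrite cell_addr /wild !asm_half cell_addr.
  have [nm0 e] := v2_shift_lt n0 (ltnSn _) hm.
  by rewrite cell_addr /wild !asm_cell (negbTE nm0) (negbTE n0) e cell_addr.
subst n; rewrite !add0r in xn pt.
suff [y yx [j hj]] : exists2 y, y < x & exists j, forall i f u,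
   (j <= i)%N -> y < sigma u <= x -> place i f u = u.
  exists (Num.max y (-(1/2))); first by rewrite gt_max yx; case/andP: xn.
  exists j => z /andP[]; rewrite gt_max => /andP[yz z2] zx m hm.
  have [->|[u zu]] : z = (0 + 1)%:~R - 1/2 \/ exists u, z = (0:int)%:~R + sigma u.
    by rewrite !add0r in pt *; apply: pt; lra.
    by rewrite cell_addr /wild !asm_half cell_addr.
  rewrite zu cell_addr /wild !asm_cell add0r.
  have [->|m0] := eqVneq m 0; first by rewrite oaut1E !addr0 add0r.
  rewrite oaut1E hj -?dvd2_v2 // ?add0r 1?addrC //.
  by move: zu; rewrite add0r => <-; rewrite yz.
have [x2|x2] := ltP x (1/2).
  have [y yx [j hj]] := place_vanish (sigmaV x).
  exists (sigma y); first by rewrite -[X in _ < X]sigmaVK; [apply: sigma_lt | lra].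
  exists j => i f u ji /andP[yu ux]; apply: hj => //.
  move: yu; rewrite (leW_mono (le_mono (@sigma_lt F))) => ->.
  by rewrite -(le_mono (@sigma_lt F)) sigmaVK //; lra.
have [y [j hj]] := place_vanish_above.
exists (sigma y); first by have := sigma_bnd y; lra.
exists j => i f u ji /andP[yu ux]; apply: hj => //.
by move: yu; rewrite (leW_mono (le_mono (@sigma_lt F))).
Qed.

(** The gap between [u] and [1] is the room used in [inner_commg] to extend [sigma \o sigma] from
    the support. *)
Definition inner f := exists2 u : F, 0 < u < 1 & fixes_off (-u) u f.

Lemma on_fixes (C : int -> bool) f (c e x : F) : -1 <= c -> e <= 1 -> fixes_off c e f ->
  (forall m, C m -> ~~ (3/8 * c < x - m%:~R < 3/8 * e)) -> on C f x = x.
Proof.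
move=> c1 e1 hf hC; rewrite /on; case: (cellP x) hC => [n|n y] hC.
  by rewrite asm_half.
rewrite asm_cell; case: ifP => // Cn; rewrite hf //.
have := hC n Cn; rewrite addrAC subrr add0r; apply: contra => ceY.
by rewrite sigma_lin; lra.
Qed.

(** * Normal subgroups and the double commutator trick *)

Definition normal_in (S N : oaut F -> Prop) :=
  [/\ subgrp N, forall f, N f -> S f & forall f g, N f -> S g -> N (f ^ g)%g].

Definition squeezing (K : oaut F -> Prop) := forall u c e : F,
  0 < u < 1 -> -1 < c -> c < e -> e < 1 ->
  exists2 p, K p & forall x, -u <= x <= u -> c < p x < e.

Lemma conj_fixes_off f g (a b c e : F) : fixes_off a b f ->
  (forall x, a < x < b -> c < g x < e) -> fixes_off c e (f ^ g^-1)%g.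
Proof.
move=> hf hg x xn; rewrite /conjg invgK !oautME hf ?oautVK //.
by apply: contra xn => /hg; rewrite oautVK.
Qed.

(** Inverting [w] makes some point move to the right, and conjugating by a multiple of [1/8] brings
    that point close to [0], well inside the linear range of [sigma]. *)
Lemma normal_witness S N w : subgrp S -> (forall m, S (trans (m%:~R / 8))) ->
  normal_in S N -> N w -> w <> 1%g ->
  exists2 w', N w' & exists2 x, 0 <= x < 1/8 & x < w' x.
Proof.
move=> hS St [hN NS NJ] Nw w1.
suff [w' Nw' [x xw]] : exists2 w', N w' & exists x, x < w' x.
  pose m := Num.floor (8 * x).
  have : m%:~R <= 8 * x < (m + 1)%:~R by exact: floor_itv.
  rewrite intrD => hm.
  exists (w' ^ trans (m%:~R / 8))%g; first exact: NJ.
  exists (x - m%:~R / 8); first lra.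
  by rewrite /conjg !oautME transV !transE subrK; lra.
have [x xw] : exists x, w x <> x.
  by apply: contra_notP w1 => h; apply: oautP => x; apply: contra_notP h => h; exists x.
have [wx|wx] : x < w x \/ w x < x by case: (ltgtP x (w x)) => h; [left|right|case: xw].
  by exists w => //; exists x.
exists w^-1%g; first exact: subgrpV.
by exists x; rewrite -(oaut_ltE w) oautVK.
Qed.

(** [al] and [be] are copies of [f] and [g] squeezed into the translates by [2 ^ j Z] of an interval
    that [w] displaces. Then [de], the conjugate of [al^-1] by [w^-1], commutes with [be], so
    [[~ al, be] = [~ de * al, be]], while [de * al] is a commutator involving [w] and lies in
    [N]. *)
Lemma normal_contains S N w : subgrp S -> (forall f, S f -> left_periodic f) ->
  (forall m, S (trans (m%:~R / 8))) -> normal_in S N -> N w -> w <> 1%g ->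
  squeezing (fun p => forall i, S (on (dvd2 i) p)) ->
  forall f g, inner f -> inner g ->
  (forall i, S (on (dvd2 i) f)) -> (forall i, S (on (dvd2 i) g)) ->
  N (diag [~ f, g]%g).
Proof.
move=> hS SLP St hNS Nw w1 sq f g [u u1 hf] [v v1 hg] Sf Sg.
have [{Nw w1}w Nw [x x0 xw]] := normal_witness hS St hNS Nw w1.
have [hN NS NJ] := hNS.
have [y yx [j0 hj0]] := SLP _ (NS _ Nw) x.
(* Close enough to [x] for [w] to be periodic on the interval from [y1] to [x] and to push it beyond
   [x]. *)
pose y1 := Num.max (Num.max y (w^-1%g x)) (- (1/8)).
have y1x : y1 < x.
  by rewrite !gt_max yx -(oaut_ltE w) oautVK xw /=; lra.
have wy1 : x <= w y1 by rewrite -{1}(oautVK w x) oaut_le !le_max lexx orbT.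
have yy1 : y <= y1 by rewrite !le_max lexx.
have y18 : - (1/8) <= y1 by rewrite le_max lexx orbT.
clearbody y1.
(* The period exceeds [w x + 2], so the displaced interval ends before the next translate begins. *)
pose j := maxn j0 (Num.bound (w x + 2)).
have jb : w x + 2 < (pow2 j)%:~R.
  apply: lt_trans (archi_boundP _) _; first lra.
  rewrite /pow2 -pmulrn ltr_nat (leq_ltn_trans (leq_maxr j0 _)) //.
  exact: ltn_expl.
have jp m : dvd2 j m -> forall z, y1 < z <= x -> w (z + m%:~R) = w z + m%:~R.
  move=> hm z zx; apply: hj0; first by lra.
  by apply: dvd2W hm; rewrite leq_maxl.
clearbody j; pose C := dvd2 j.
have u'1 : 0 < Num.max u v < 1 by case: (leP u v) => _.
(* The factor [8/3] undoes the slope of [sigma]: in a cell the squeezed supports lie between [y1]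
   and [x]. *)
have [p Sp hp] := sq (Num.max u v) (8/3 * y1) (8/3 * x) u'1 ltac:(lra) ltac:(lra) ltac:(lra).
have mv h k : 0 < k < 1 -> k <= Num.max u v -> fixes_off (-k) k h ->
    fixes_off (8/3 * y1) (8/3 * x) (h ^ p^-1)%g.
  by move=> k1 ku hk; apply: (conj_fixes_off hk) => z zk; apply: hp; lra.
have e t : 3/8 * (8/3 * t) = t :> F by field.
have {}mv h k z : 0 < k < 1 -> k <= Num.max u v -> fixes_off (-k) k h ->
    (forall m, C m -> ~~ (y1 < z - m%:~R < x)) -> on C (h ^ p^-1)%g z = z.
  move=> k1 ku hk hC; apply: on_fixes (mv h k k1 ku hk) _ => [||m /hC].
  - lra.
  - lra.
  by rewrite !e.
pose al := on C (f ^ p^-1)%g; pose be := on C (g ^ p^-1)%g.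
pose de := (al^-1 ^ w^-1)%g.
have Sw := NS _ Nw.
have SJ h k : S h -> S k -> S (h ^ k)%g by apply: subgrpJ.
have SV h : S h -> S h^-1%g by apply: subgrpV.
have Sal : S al by rewrite /al -onJ -onV; apply: (SJ); [exact: Sf | apply: SV; exact: Sp].
have Sbe : S be by rewrite /be -onJ -onV; apply: (SJ); [exact: Sg | apply: SV; exact: Sp].
have cde : commute de be.
  apply: disjoint_commute => z.
  have [->|/eqP bz] := eqVneq (be z) z; [by right | left].
  have [m Cm zm] : exists2 m, C m & y1 < z - m%:~R < x.
    apply: contra_notP bz => h; apply: (mv _ v) => //; first by rewrite le_max lexx orbT.
    by move=> m Cm; apply/negP => zm; apply: h; exists m.
  rewrite /de /conjg invgK !oautME -[RHS](oautVK w); congr (w _).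
  apply: oautVP; set q := (w^-1%g z); apply: (mv _ u) => //; first by rewrite le_max lexx.
  move=> m' Cm'; apply/negP => qm.
  have := jp m' Cm' (q - m'%:~R) ltac:(lra); rewrite subrK oautVK => zE.
  have h1 : w y1 < w (q - m'%:~R) by rewrite oaut_ltE; lra.
  have h2 : w (q - m'%:~R) < w x by rewrite oaut_ltE; lra.
  (* The bounds give [0 < m - m' < 2 ^ j], against divisibility by [2 ^ j]. *)
  have mm : dvd2 j (m - m') by apply: dvd2B.
  have [k mk] := dvd2P _ _ mm.
  have := congr1 (fun i : int => i%:~R : F) mk; rewrite intrB intrM => mkF.
  have k0 : 0 < k.
    rewrite ltNge; apply/negP => k0; have kF : k%:~R <= 0 :> F by rewrite lerz0.
    have pF : 0 <= (pow2 j)%:~R :> F by rewrite ler0z ltW ?pow2_gt0.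
    by have := mulr_le0_ge0 kF pF; lra.
  have k1 : 1 <= k%:~R :> F by rewrite ler1z -gtz0_ge1.
  have pF : 0 <= (pow2 j)%:~R :> F by rewrite ler0z ltW ?pow2_gt0.
  have := ler_wpM2r pF k1; rewrite mul1r; lra.
have Nda : N (de * al)%g.
  have -> : (de * al = w * (w^-1) ^ al)%g.
    by rewrite /de /conjg invgK !mulgA.
  by apply: subgrpM => //; apply: NJ => //; apply: subgrpV.
have : N [~ al, be]%g.
  have -> : [~ al, be]%g = [~ (de * al)%g, be]%g.
    have dbe : (de ^ be)%g = de by rewrite conjgE cde mulKg.
    by rewrite /commg conjMg dbe invgM -[RHS]mulgA mulKg.
  by rewrite /commg; apply: subgrpM => //; [apply: subgrpV | apply: NJ].
(* Conjugating back removes the squeezing; [on_split] then spreads the commutator to all cells. *)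
rewrite onR -conjRg -onJ -onV => /NJ /(_ (Sp j)); rewrite conjgKV /C => NC.
rewrite -on_diag; elim: j {jb jp C mv al be de Sal Sbe cde Nda} NC => // j IH NC.
apply: IH; rewrite on_split; apply: subgrpM => //; apply: (NJ) => //; apply: SV.
by have := St (8 * pow2 j); rewrite intrM mulrAC divff ?mul1r //; lra.
Qed.

End Dynamics.

(** * Local automorphisms as commutators *)

Section Pieces.
Variable F : archiRealFieldType.
Implicit Types (f g w : oaut F) (x y z : F) (n m : int) (a b : nat -> oaut F).

Local Notation bshift := (bshift F).
Local Notation shrink := (shrink F).
Local Notation second_shift := (second_shift F).

Lemma inner_emb f : inner (emb f).
Proof. by exists (1/2); [lra | exact: emb_fixes]. Qed.

Lemma inner_fixes f : inner f -> fixes_off (-1) 1 f.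
Proof. by case=> u u1; apply: fixes_offW; lra. Qed.

Lemma conj_fixes_offV f g (a b c e : F) : fixes_off a b f ->
  (forall x, a < g x < b -> c < x < e) -> fixes_off c e (f ^ g)%g.
Proof.
move=> hf hg x xn; rewrite /conjg !oautME; apply: oautVP; rewrite hf //.
by apply: contra xn => /hg.
Qed.

(** A ray and its translate differ by one twice compressed copy of [f] ([ray_bshift]). Conjugation
    by some [g] that extends [sigma \o sigma] from the support turns this copy into [f]. *)
Lemma inner_commg f : inner f -> exists2 h : oaut F * oaut F,
  inner h.1 /\ inner h.2 & f = [~ h.1, h.2]%g.
Proof.
move=> [u u1 hf]; pose v := (1 + u) / 2; pose M := (v - u)^-1.
have vu : 0 < v - u by rewrite /v; lra.
have M0 : 0 < M by rewrite invr_gt0.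
have MK : M * (v - u) = 1 by rewrite mulVf ?gt_eqF.
have M1 : 1 <= M by rewrite invf_ge1 // /v; lra.
(* These lines send [v] to [1/2] and [- v] to [- (1/2)], so conjugation by [g] keeps supports within
   [(- v, v)]; slope [M] is steep enough to leave [g] unchanged on [[- u, u]]. *)
pose up := aff (1/2 - M * v) M0; pose dn := aff (M * v - 1/2) M0.
have upE x : up x = M * x + (1/2 - M * v) by [].
have dnE x : dn x = M * x + (M * v - 1/2) by [].
pose g := omax up (omin (aff 0 (shrink_slope_gt0 F)) dn).
have gE x : g x = Num.max (up x) (Num.min (9 / 64 * x) (dn x)).
  by rewrite /g omaxE ominE /= addr0.
have gv : g v = 1/2.
  have e : up v = 1/2 by rewrite upE; lra.
  rewrite gE e; apply/max_idPl; rewrite ge_min; apply/orP; left; rewrite /v; lra.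
have gu x : - u <= x <= u -> g x = sigma (sigma x).
  move=> xu; rewrite sigma2_lin; last lra.
  have h1 : M * x <= M * u by rewrite ler_pM2l //; lra.
  have h2 : M * - u <= M * x by rewrite ler_pM2l //; lra.
  rewrite gE; have -> : Num.min (9 / 64 * x) (dn x) = 9 / 64 * x.
    by apply/min_idPl; rewrite dnE; lra.
  by apply/max_idPr; rewrite upE; lra.
have gNv : g (- v) = - (1/2).
  have e : dn (- v) = - (1/2) by rewrite dnE; lra.
  have h : M * v >= v by rewrite ler_peMl //; rewrite /v; lra.
  rewrite gE e; have -> : Num.min (9 / 64 * - v) (- (1 / 2)) = - (1/2) :> F.
    by apply/min_idPr; rewrite /v; lra.
  by apply/max_idPr; rewrite upE; rewrite /v in h *; lra.
have inJ h : inner (emb h ^ g)%g.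
  exists v; first by rewrite /v; lra.
  apply: conj_fixes_offV (emb_fixes _) _ => x.
  by rewrite -{1}gNv -gv !oaut_ltE.
exists ((ray f)^-1 ^ g, bshift^-1 ^ g)%g => /=.
  by split; rewrite /ray embV; apply: inJ.
rewrite -conjRg /commg invgK conjVg ray_bshift.
rewrite -(conj_emb_emb _ hf gu) ?conjgKV //; lra.
Qed.

Lemma squeeze_exists (u c e : F) :
  0 < u < 1 -> -1 < c -> c < e -> e < 1 ->
  exists2 p, inner p & forall x, -u <= x <= u -> c < p x < e.
Proof.
move=> u1 c1 ce e1; pose m := (c + e) / 2.
pose v := (1 + Num.max u (Num.max (-c) e)) / 2.
have [uv ev cv v1] : [/\ u < v, e < v, - c < v & v < 1].
  rewrite /v; set k := Num.max _ _.
  have uk : u <= k by rewrite le_max lexx.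
  have ck : - c <= k by rewrite !le_max lexx orbT.
  have ek : e <= k by rewrite !le_max lexx !orbT.
  have k1 : k < 1 by rewrite !gt_max; apply/and3P; split; lra.
  by split; lra.
clearbody v.
(* Slope [l] brings [[-1, 1]] within [(e - c) / 4] of [m]. With slope [M] the outer line takes the
   value [v - 2 < -1] at [u], so it does not interfere. *)
pose l := (e - c) / 8; have l0 : 0 < l by rewrite /l; lra.
have l1 : l <= 1 by rewrite /l; lra.
pose M := 2 / (v - u).
have vu : 0 < v - u by lra.
have M0 : 0 < M by rewrite divr_gt0 //; lra.
have MK : M * (v - u) = 2 by rewrite divfK ?gt_eqF.
have M1 : 1 <= M by rewrite ler_pdivlMr //; lra.
have mb : c < m < e by rewrite /m; lra.
pose p1 := squeeze_left l0 M0 m (- v); pose p2 := squeeze_right l0 M0 m v.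
have f1 : fixes_off (- v) m p1 by apply: squeeze_left_fixes.
have f2 : fixes_off m v p2 by apply: squeeze_right_fixes.
have lb x : -1 <= x <= 1 -> c < m + l * (x - m) < e.
  move=> x1; have h1 : l * (x - m) <= l * 2 by rewrite ler_pM2l //; lra.
  have h2 : l * - 2 <= l * (x - m) by rewrite ler_pM2l //; lra.
  by rewrite /m /l in h1 h2 *; lra.
have p2u : p2 u < e.
  rewrite /p2 squeeze_rightE; have -> : v + M * (u - v) = v - 2 by rewrite -MK; ring.
  have /andP[_ h] : c < m + l * (u - m) < e by apply: lb; lra.
  by rewrite gt_min gt_max h; apply/orP; right; lra.
have p1u : c < p1 (- u).
  rewrite /p1 squeeze_leftE; have -> : - v + M * (- u - - v) = 2 - v by rewrite -MK; ring.
  have /andP[h _] : c < m + l * (- u - m) < e by apply: lb; lra.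
  by rewrite lt_max lt_min h; apply/orP; right; lra.
exists (p1 * p2)%g.
  by exists v; [lra|apply: fixes_offM; [apply: fixes_offW f1|apply: fixes_offW f2]; lra].
move=> x /andP[xu ux]; rewrite oautME; apply/andP; split.
  have [um|um] := leP (- u) m.
    have e2 : p2 (- u) = - u by rewrite f2 // ltNge um.
    by apply: lt_le_trans p1u _; rewrite oaut_le -{1}e2 oaut_le.
  have e1' : p1 m = m by rewrite f1 // ltxx andbF.
  have e2 : p2 m = m by rewrite f2 // ltxx.
  apply: (@lt_le_trans _ _ m); first by case/andP: mb.
  by rewrite -{1}e1' -{1}e2 !oaut_le; lra.
have p2x : p2 x < e by apply: le_lt_trans p2u; rewrite oaut_le.
have [um|um] := leP m (p2 x); first by rewrite f1 // [_ < m]ltNge um andbF.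
have e1' : p1 m = m by rewrite f1 // ltxx andbF.
apply: (@le_lt_trans _ _ m); last by case/andP: mb.
by rewrite -[X in _ <= X]e1' oaut_le ltW.
Qed.

Lemma diag_fixes f x : (forall n y, x = n%:~R + sigma y -> f y = y) -> diag f x = x.
Proof.
rewrite /diag; case: (cellP x) => [n|n y] h; first by rewrite asm_half.
by rewrite asm_cell (h n y).
Qed.

Lemma diag_lin f n y : -1 <= y <= 1 -> -1 <= f y <= 1 ->
  diag f (n%:~R + 3/8 * y) = n%:~R + 3/8 * f y.
Proof. by move=> y1 fy1; rewrite -(sigma_lin y1) /diag asm_cell sigma_lin. Qed.

Lemma diag_periodic f n x : diag f (x + n%:~R) = diag f x + n%:~R.
Proof.
rewrite /diag; case: (cellP x) => [m|m y]; rewrite cell_addr.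
  by rewrite !asm_half cell_addr.
by rewrite !asm_cell cell_addr.
Qed.

(** [f] preserves every cell since it fixes the half-integers, and it acts alike in all of them.
    Read through [sigma] it is inner, because [1/3 = sigma (8/9)]. *)
Lemma periodic_diag f : (forall x, f (x + 1) = f x + 1) ->
  (forall x, 1/3 <= x <= 2/3 -> f x = x) -> exists2 h, inner h & f = diag h.
Proof.
move=> per fx.
have perN n x : f (x + n%:~R) = f x + n%:~R.
  have perP (k : nat) y : f (y + k%:R) = f y + k%:R.
    by elim: k => [|k IH]; rewrite ?addr0 // -natr1 !addrA per IH.
  case: n => k; first exact: perP.
  rewrite NegzE mulrNz -pmulrn; have := perP k.+1 (x - k.+1%:R).
  by rewrite subrK => ->; rewrite addrK.
have f2 : f (1/2) = 1/2 by apply: fx; lra.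
have fN x : -(2/3) <= x <= -(1/3) -> f x = x.
  by move=> x1; have := per x; have := fx (x + 1) ltac:(lra); lra.
have fN2 : f (-(1/2)) = -(1/2) by apply: fN; lra.
have fb x : -(1/2) < x < 1/2 -> -(1/2) < f x < 1/2.
  case/andP=> h1 h2; apply/andP.
  by split; [rewrite -[X in X < _]fN2 | rewrite -[X in _ < X]f2]; rewrite oaut_ltE.
have fVb x : -(1/2) < x < 1/2 -> -(1/2) < (f^-1)%g x < 1/2.
  case/andP=> h1 h2; apply/andP.
  by split; rewrite -(oaut_ltE f) oautVK ?f2 ?fN2.
have gK : cancel (@sigmaV F \o f \o @sigma F) (@sigmaV F \o f^-1%g \o @sigma F).
  by move=> y; rewrite /comp sigmaVK ?fb ?sigma_bnd // oautKV sigmaK.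
have gVK : cancel (@sigmaV F \o f^-1%g \o @sigma F) (@sigmaV F \o f \o @sigma F).
  by move=> y; rewrite /comp sigmaVK ?fVb ?sigma_bnd // oautVK sigmaK.
have g_lt : {homo (@sigmaV F \o f \o @sigma F) : x y / x < y}.
  move=> x y xy; rewrite /comp -(leW_mono (le_mono (@sigma_lt F))).
  by rewrite !sigmaVK ?fb ?sigma_bnd // oaut_ltE; apply: sigma_lt.
exists (OAut gK gVK g_lt).
  exists (8/9); first lra.
  move=> y yn /=; suff -> : f (sigma y) = sigma y by rewrite sigmaK.
  have e1 : sigma (8/9) = 1/3 :> F by rewrite sigma_lin; lra.
  have sb := sigma_bnd y; have [y0|y0] := leP (8/9) y.
    have := le_mono (@sigma_lt F) (8/9) y; rewrite y0 e1 => h.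
    by apply: fx; lra.
  have y1 : y <= - (8/9) by move: yn; rewrite y0 andbT -leNgt.
  have := le_mono (@sigma_lt F) y (-(8/9)); rewrite y1 sigmaN e1 => h.
  by apply: fN; lra.
apply: oautP => x; rewrite /diag; case: (cellP x) => [n|n y].
  by rewrite asm_half addrC perN fN2.
by rewrite asm_cell addrC perN /= sigmaVK ?fb ?sigma_bnd // addrC.
Qed.

(** The translation moves the ends of the cells, so it is fragmented: [diag h.1] agrees with it near
    the integers, and the quotient, which is trivial there, becomes a [diag] once shifted by half a
    cell. *)
Lemma diag_split : exists2 h : oaut F * oaut F, inner h.1 /\ inner h.2 &
  trans (1/8) = ((diag h.2 ^ trans (1/2)) * diag h.1)%g.
Proof.
have h5 : 0 < 5 :> F by lra.
have h15 : 0 < 1/5 :> F by lra.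
(* The outer lines meet the identity at [-11/12] and [11/12], and the translation by [1/3] at [-5/6]
   and [1/2]; through the slope [3/8], a shift by [1/3] becomes one by [1/8]. *)
pose a0 := omax 1%g (omin (trans (1/3)) (omin (aff (11/3) h5) (aff (11/15) h15))).
have a0E x : a0 x = Num.max x (Num.min (x + 1/3) (Num.min (5 * x + 11/3) (1/5 * x + 11/15))).
  by rewrite /a0 omaxE !ominE transE.
have a0i : inner a0.
  exists (11/12); first lra.
  move=> x xn; rewrite a0E; apply/max_idPl; rewrite !ge_min.
  have [x1|x1] := leP (11/12) x; first by apply/or3P; apply: Or33; lra.
  by apply/or3P; apply: Or32; move: xn; rewrite x1 andbT -leNgt; lra.
have a0t x : -(5/6) <= x <= 1/2 -> a0 x = x + 1/3.
  move=> x1; rewrite a0E (min_idPl _); first by apply/max_idPr; lra.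
  by rewrite le_min; lra.
have dt x : -(5/16) <= x <= 3/16 -> diag a0 x = x + 1/8.
  move=> x1; have e := a0t (8/3 * x) ltac:(lra).
  have h1 : -1 <= 8/3 * x <= 1 by lra.
  have h2 : -1 <= a0 (8/3 * x) <= 1 by rewrite e; lra.
  have := diag_lin 0 h1 h2; rewrite e !add0r => h.
  by rewrite (_ : x = 3/8 * (8/3 * x)) ?{1}h; field.
pose P := (trans (1/8) * (diag a0)^-1)%g; pose Q := (P ^ (trans (1/2))^-1)%g.
have PE x : P (diag a0 x) = x + 1/8 by rewrite /P oautME oautKV transE.
have Pper x : P (x + 1) = P x + 1.
  rewrite -[x](oautVK (diag a0)); set y := ((diag a0)^-1)%g x.
  have := diag_periodic a0 1 y; rewrite mulr1z => <-; rewrite !PE; ring.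
have QE x : Q x = P (x - 1/2) + 1/2.
  by rewrite /Q /conjg invgK !oautME transV !transE.
have [|x x1|h hi Qh] := @periodic_diag Q.
- by move=> x; rewrite !QE (_ : x + 1 - 1/2 = x - 1/2 + 1) ?Pper; ring.
- have := PE (x - 1/2 - 1/8); rewrite dt; last lra.
  by rewrite QE subrK => ->; rewrite !subrK.
exists (a0, h) => //=; rewrite -Qh /Q conjgKV /P mulgVK //.
Qed.

(** [shrink_right] is not inner, but in a cell its support is [(0, 11/24)]; shifted left by [1/4],
    it avoids a neighbourhood of the half-integers. *)
Lemma diag_squeeze_right : exists2 h, inner h &
  diag (shrink_right F) = (diag h ^ (trans (1/4))^-1)%g.
Proof.
have fr : fixes_off 0 3 (shrink_right F) by apply: squeeze_right_fixes; lra.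
pose P := diag (shrink_right F); have [|x x1|h hi Ph] := @periodic_diag (P ^ trans (1/4))%g.
- move=> x; rewrite /conjg !oautME transV !transE.
  by have := diag_periodic (shrink_right F) 1 (x + 1/4); rewrite -/P mulr1z => e; rewrite addrAC e addrAC.
- rewrite /conjg !oautME transV !transE.
  suff -> : P (x + 1/4) = x + 1/4 by rewrite addrK.
  apply: diag_fixes => n y e; apply: fr; apply/negP => y3.
  have s0 : 0 < sigma y by rewrite -[0](_ : sigma 0 = 0) ?sigma_lt //; [case/andP: y3|rewrite sigma_lin; lra].
  have s3 : sigma y < 11/24.
    have -> : 11/24 = sigma 3 :> F by rewrite sigma_gt; [field|lra].
    by apply: sigma_lt; case/andP: y3.
  have n1 : (0 < n)%R by rewrite -(ltr0z F); lra.
  have n2 : (n < 1)%R by rewrite -(ltrz1 F); lra.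
  by lia.
by exists h => //; rewrite -Ph conjgK.
Qed.

Lemma diag_squeeze_left : exists2 h, inner h &
  diag (shrink_left F) = (diag h ^ (trans (- (1/4)))^-1)%g.
Proof.
have fr : fixes_off (-3) 0 (shrink_left F) by apply: squeeze_left_fixes; lra.
pose P := diag (shrink_left F); have [|x x1|h hi Ph] := @periodic_diag (P ^ trans (-(1/4)))%g.
- move=> x; rewrite /conjg !oautME transV !transE.
  by have := diag_periodic (shrink_left F) 1 (x - 1/4); rewrite -/P mulr1z => e; rewrite addrAC e addrAC.
- rewrite /conjg !oautME transV !transE.
  suff -> : P (x - 1/4) = x - 1/4 by rewrite addrK.
  apply: diag_fixes => n y e; apply: fr; apply/negP => y3.
  have s0 : sigma y < 0 by rewrite -[0](_ : sigma 0 = 0) ?sigma_lt //; [case/andP: y3|rewrite sigma_lin; lra].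
  have s3 : - (11/24) < sigma y.
    have -> : - (11/24) = sigma (-3) :> F by rewrite sigmaN sigma_gt; [field|lra].
    by apply: sigma_lt; case/andP: y3.
  have n1 : (0 < n)%R by rewrite -(ltr0z F); lra.
  have n2 : (n < 1)%R by rewrite -(ltrz1 F); lra.
  by lia.
by exists h => //; rewrite -Ph conjgK.
Qed.

Definition gens a b : seq (oaut F) :=
  [:: trans (1/8); diag bshift; diag shrink; diag second_shift; diag_upper_shift F; diag_ladder_lift F; wild a; wild b].

(** [L] is chosen before the sequences [a] and [b], which can therefore be built afterwards to
    produce the elements of [L] as commutators. *)
Lemma gens_in_normal : exists2 L : seq (oaut F), (forall l, l \in L -> inner l) &
  forall S N a b, subgrp S -> normal_in S N ->
  (forall m, S (trans (m%:~R / 8))) -> (forall g, g \in gens a b -> S g) ->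
  (forall i, fixes_off (-1) 1 (a i)) -> (forall i, fixes_off (-1) 1 (b i)) ->
  (forall l, l \in L -> N (diag l)) -> forall g, g \in gens a b -> N g.
Proof.
have [[h1 h2] /= [i1 i2] tE] := diag_split.
have [h3 i3 rE] := diag_squeeze_right.
have [h4 i4 lE] := diag_squeeze_left.
pose wn := nest (fun=> upper_shift F); pose vn := nest (fun=> ladder_lift F).
exists [:: h1; h2; h3; h4; bshift; second_shift; wn; vn].
  move=> l; rewrite !inE; do !(case/orP => [/eqP -> //|]); try exact: inner_emb.
  by move=> /eqP ->; apply: inner_emb.
move=> S N a b hS [hN NS NJ] St Sg ha hb NL.
have N1 : N (diag h1) by apply: NL; rewrite !inE eqxx.
have N2 : N (diag h2) by apply: NL; rewrite !inE eqxx ?orbT.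
have N3 : N (diag h3) by apply: NL; rewrite !inE eqxx ?orbT.
have N4 : N (diag h4) by apply: NL; rewrite !inE eqxx ?orbT.
have Ns : N (diag bshift) by apply: NL; rewrite !inE eqxx ?orbT.
have No : N (diag second_shift) by apply: NL; rewrite !inE eqxx ?orbT.
have NW : N (diag_upper_shift F) by apply: NL; rewrite !inE eqxx ?orbT.
have NV : N (diag_ladder_lift F) by apply: NL; rewrite !inE eqxx ?orbT.
have Nt : N (trans (1/8)).
  rewrite tE; apply: subgrpM => //; apply: (NJ) => //.
  by have := St 4; rewrite (_ : 4%:~R / 8 = 1 / 2 :> F) //; field.
have Nr : N (diag shrink).
  rewrite -diagM; apply: subgrpM => //; rewrite ?rE ?lE; apply: (NJ) => //.
    rewrite transV opprK; have := St 2.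
    by rewrite (_ : 2%:~R / 8 = 1 / 4 :> F) //; field.
  rewrite transV; have := St (-2).
  by rewrite (_ : (-2)%:~R / 8 = - (1 / 4) :> F) // mulrNz; field.
have Nw c : S (wild c) -> (forall i, fixes_off (-1) 1 (c i)) -> N (wild c).
  move=> Sc hc; have := wild_rel hc.
  (* Regrouped, the left side of [wild_rel] is a conjugate of [diag_upper_shift] times its inverse,
     hence lies in [N]. *)
  have -> : (wild c * (wild c ^ (diag_upper_shift F)^-1)^-1 = (diag_upper_shift F) ^ (wild c)^-1 * (diag_upper_shift F)^-1)%g.
    by rewrite /conjg !invgM !invgK !mulgA.
  move=> e; rewrite -[wild c](conjgKV (diag_ladder_lift F)) -e; apply: (NJ); last exact: NS.
  apply: (subgrpM hN); last exact: (subgrpV hN NW).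
  by apply: (NJ _ _ NW); apply: (subgrpV hS Sc).
move=> g; rewrite !inE.
do !(case/orP => [/eqP -> //|]).
  by apply: Nw => //; apply: Sg; rewrite !inE eqxx ?orbT.
by move/eqP => ->; apply: Nw => //; apply: Sg; rewrite !inE eqxx ?orbT.
Qed.
End Pieces.

(** * Groups generated by a finite sequence *)

(* The boolean marks inverses; an index beyond the generators stands for [1]. *)
Definition word := seq (nat * bool).

Section Words.
Local Open Scope group_scope.

Fixpoint wev (G : groupType) (s : seq G) (w : word) : G :=
  if w is (i, b) :: w' then (if b then (nth 1 s i)^-1 else nth 1 s i) * wev s w' else 1.

Definition winv (w : word) : word := rev [seq (i.1, ~~ i.2) | i <- w].

Lemma wev_cat (G : groupType) (s : seq G) v w : wev s (v ++ w) = wev s v * wev s w.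
Proof. by elim: v => [|[i b] v IH] /=; rewrite ?mul1g // IH mulgA. Qed.

Lemma wev_inv (G : groupType) (s : seq G) w : wev s (winv w) = (wev s w)^-1.
Proof.
elim: w => [|[i b] w IH] /=; first by rewrite invg1.
rewrite /winv /= rev_cons -cats1 wev_cat -/(winv w) IH invgM /= mulg1.
by case: b; rewrite /= ?invgK.
Qed.

Lemma wev_map (G H : groupType) (f : {multiplicative G -> H}) (s : seq G) w :
  f (wev s w) = wev (map f s) w.
Proof.
have f1 : f 1 = 1 by apply: (mulgI (f 1)); rewrite -gmulfM !mulg1.
have fV x : f x^-1 = (f x)^-1 by apply/esym/mulg1_eq; rewrite -gmulfM mulgV.
elim: w => [|[i b] w IH] //=; rewrite gmulfM IH; congr (_ * _).
have e : f (nth 1 s i) = nth 1 (map f s) i.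
  have [is'|si] := ltnP i (size s); first by rewrite (nth_map 1).
  by rewrite !nth_default ?size_map.
by case: b; rewrite ?fV e.
Qed.

Definition wordset (G : groupType) (s : seq G) (x : G) : Prop := exists w, x = wev s w.
Definition span_pred (G : groupType) (s : seq G) : pred G := fun x => `[< wordset s x >].

Lemma span_closed (G : groupType) (s : seq G) : group_closed (span_pred s).
Proof.
split; first by apply/asboolP; exists [::].
move=> x y /asboolP[v ->] /asboolP[w ->]; apply/asboolP.
by exists (v ++ winv w); rewrite wev_cat wev_inv.
Qed.

Definition spangrp (G : groupType) (s : seq G) := {x : G | span_pred s x}.
HB.instance Definition _ (G : groupType) (s : seq G) := SubChoice.on (spangrp s).
HB.instance Definition _ (G : groupType) (s : seq G) :=
  SubChoice_isSubGroup.Build G (span_pred s) (spangrp s) (span_closed s).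

End Words.
Section SpanTheory.
Local Open Scope group_scope.
Variables (G : groupType) (s : seq G).

Lemma valV (x : spangrp s) : \val x^-1 = (\val x)^-1.
Proof. by apply/esym/mulg1_eq; rewrite -valM mulgV val1. Qed.

Lemma nth_span i : span_pred s (nth 1 s i).
Proof. by apply/asboolP; exists [:: (i, false)]; rewrite /= mulg1. Qed.

Definition span_gen i : spangrp s := exist _ (nth 1 s i) (nth_span i).
Definition span_gens : seq (spangrp s) := mkseq span_gen (size s).

Lemma span_fg : finitely_generated (spangrp s).
Proof.
exists [set` span_gens]%classic; first exact: finite_seq.
move=> S hS AS; apply/seteqP; split => // x _.
have S1 : S 1 by have := hS.1; rewrite in_setE.
have SB y z : S y -> S z -> S (y / z).
  by move=> Sy Sz; have := hS.2 y z; rewrite !in_setE; apply.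
have SV y : S y -> S y^-1 by move=> Sy; have := SB 1 y S1 Sy; rewrite div1g.
have SM y z : S y -> S z -> S (y * z).
  by move=> Sy Sz; rewrite -[z]invgK; apply: SB => //; apply: SV.
have Sg i : S (span_gen i).
  have [si|si] := ltnP i (size s).
    by apply: AS => /=; apply/mapP; exists i; rewrite ?mem_iota.
  have -> : span_gen i = 1 by apply: val_inj; rewrite /= nth_default.
  exact: S1.
have [w xw] := asboolP _ (valP x).
elim: w x xw => [|[i b] w IH] x xw; first by have -> : x = 1 by exact: val_inj.
pose g := if b then (span_gen i)^-1 else span_gen i.
have -> : x = g * (g^-1 * x) by rewrite mulVKg.
apply: SM; first by rewrite /g; case: b {xw g} => //; apply: SV.
apply: IH; rewrite valM valV xw /= mulgA.
by rewrite /g; case: b {xw g}; rewrite ?valV /= ?invgK ?mulVg ?mulgV mul1g.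
Qed.

Lemma val_wev w : \val (wev span_gens w) = wev s w.
Proof.
elim: w => [|[i b] w IH]; first by [].
transitivity (\val (if b then (nth 1 span_gens i)^-1 else nth 1 span_gens i) * \val (wev span_gens w)).
  by rewrite -valM.
rewrite IH; congr (_ * _).
have e : \val (nth 1 span_gens i) = nth 1 s i.
  have [si|si] := ltnP i (size s); first by rewrite nth_mkseq.
  by rewrite !nth_default ?size_mkseq.
by case: b; rewrite ?valV e.
Qed.

Lemma span_wev (x : spangrp s) : exists w, x = wev span_gens w.
Proof.
by have [w xw] := asboolP _ (valP x); exists w; apply: val_inj; rewrite val_wev.
Qed.

(** Moves simplicity from the subtype to predicates on [G], where the dynamical arguments take
    place. *)
Lemma span_simple : wordset s <> (fun x => x = 1) ->
  (forall N : G -> Prop, N 1 -> (forall x y, N x -> N y -> N (x / y)) ->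
     (forall x, N x -> wordset s x) ->
     (forall x y, N x -> wordset s y -> N (x ^ y)) ->
     (exists2 x, N x & x <> 1) -> forall i, (i < size s)%N -> N (nth 1 s i)) ->
  simple_group (spangrp s).
Proof.
move=> s1 hN; split.
  move=> e; apply: s1; apply/funext => x; apply/propext; split=> [hx|->]; last by exists [::].
  have hx' : span_pred s x by apply/asboolP.
  have : [set: spangrp s]%classic (exist _ x hx') by [].
  by rewrite e => /(congr1 val).
move=> N [[N1 NB] NJ].
have {}N1 : N 1 by move: N1; rewrite in_setE.
have {}NB y z : N y -> N z -> N (y / z).
  by move=> Ny Nz; have := NB y z; rewrite !in_setE; apply.
have [[x Nx x1]|N0] := pselect (exists2 x, N x & x <> 1); [right|left]; last first.
  apply/seteqP; split=> x /=; last by move=> ->.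
  by move=> Nx; apply: contra_notP N0 => x1; exists x.
pose M y := exists2 x, N x & val x = y.
have Mg : forall i, (i < size s)%N -> M (nth 1 s i).
  apply: hN.
  - by exists 1.
  - by move=> _ _ [y Ny <-] [z Nz <-]; exists (y / z); [exact: NB | rewrite valM valV].
  - by move=> _ [y _ <-]; exact: (asboolP _ (valP y)).
  - move=> _ y [z Nz <-] hy; have hy' : span_pred s y by apply/asboolP.
    exists (z ^ (exist _ y hy')); first exact: NJ.
    by rewrite /conjg !valM valV.
  - by exists (val x); [exists x | move=> /(@val_inj _ _ _ x 1)].
apply/seteqP; split=> // y _; have [w yw] := span_wev y; rewrite yw {y yw}.
have Ng i : N (nth 1 span_gens i).
  have [si|si] := ltnP i (size s); last by rewrite nth_default ?size_mkseq.
  by have [z Nz zi] := Mg i si; rewrite nth_mkseq // -(_ : z = span_gen i) //; apply: val_inj.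
have NV y : N y -> N y^-1 by move=> Ny; rewrite -div1g; apply: NB.
elim: w => [|[i b] w IH] //=; rewrite -[wev _ w]invgK; apply: NB; last exact: NV.
by case: b => //; apply: NV.
Qed.

End SpanTheory.

(** * Counting isomorphism types *)

Section Isomorphic.
Local Open Scope group_scope.

Definition mult_of (G H : groupType) (f : G -> H) (fM : {morph f : x y / x * y}) :
  {multiplicative G -> H} :=
  HB.pack f (isMultiplicative.Build G H f fM).

Lemma isomorphic_refl (G : groupType) : isomorphic G G.
Proof.
have M : {morph (@id G) : x y / x * y} by [].
by exists (mult_of M); exists id.
Qed.

Lemma isomorphic_sym (G H : groupType) : isomorphic G H -> isomorphic H G.
Proof.
move=> [f [g fK gK]].
have gM : {morph g : x y / x * y}.
  by move=> x y; apply: (can_inj fK); rewrite gmulfM !gK.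
by exists (mult_of gM); exists f.
Qed.

Lemma isomorphic_trans (G H K : groupType) :
  isomorphic G H -> isomorphic H K -> isomorphic G K.
Proof.
move=> [f [f' fK f'K]] [g [g' gK g'K]].
have M : {morph g \o f : x y / x * y} by move=> x y /=; rewrite !gmulfM.
exists (mult_of M); exists (f' \o g'); first exact: can_comp.
exact: can_comp.
Qed.

Lemma isomorphic_eq (G H : groupType) : isomorphic G H -> isomorphic G = isomorphic H.
Proof.
move=> GH; apply/funext => K; apply/propext; split.
  exact/isomorphic_trans/isomorphic_sym.
exact: isomorphic_trans.
Qed.

(** Equal sets of relators make both groups the same quotient of a free group. *)
Lemma isomorphic_relators (G H : groupType) (s : seq G) (t : seq H) :
  (forall x, wordset s x) -> (forall y, wordset t y) ->
  (forall w, wev s w = 1 <-> wev t w = 1) -> isomorphic G H.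
Proof.
move=> hs ht st.
have steq v w : wev s v = wev s w <-> wev t v = wev t w.
  have e (K : groupType) (r : seq K) : wev r v = wev r w <-> wev r (v ++ winv w) = 1.
    by rewrite wev_cat wev_inv; split=> [->|/divg1_eq]; rewrite ?mulgV.
  by rewrite !e.
have [f hf] := choice hs; have [g hg] := choice ht.
have M : {morph (fun x => wev t (f x)) : x y / x * y}.
  by move=> x y; rewrite -wev_cat; apply/steq; rewrite wev_cat -!hf.
exists (mult_of M); exists (fun y => wev s (g y)) => [x|y] /=.
  by rewrite [RHS]hf; apply/steq; rewrite -hg.
by rewrite [RHS]hg; apply/steq; rewrite -hf.
Qed.

Lemma fg_words (G : groupType) : finitely_generated G -> exists s : seq G, forall x, wordset s x.
Proof.
move=> [A /finite_seqP[s ->] hA]; exists s => x.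
have [c1 cB] := span_closed s.
have inE' y : (y \in [set x | wordset s x]%classic) = span_pred s y.
  by apply/idP/asboolP; rewrite in_setE.
suff /seteqP[_ h] : [set x | wordset s x]%classic = setT by exact: (h x I).
apply: hA; last by move=> y /= /(nthP 1) [i _ <-]; apply/asboolP/nth_span.
by split=> [|y z]; rewrite !inE' //; apply: cB.
Qed.

End Isomorphic.

Section Counting.
Local Open Scope group_scope.

(** A class is encoded by the relators of one generating sequence of one member. *)
Lemma isomorphism_types_inj (P : groupType -> Prop) : (forall G, P G -> finitely_generated G) ->
  exists f : isomorphism_types P -> (word -> Prop), injective f.
Proof.
move=> Pfg.
have h (C : isomorphism_types P) : exists S : word -> Prop, exists (G : groupType) (s : seq G),
    [/\ sval C = isomorphic G, forall x, wordset s x & forall w, S w <-> wev s w = 1].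
  case: C => C [G PG CG] /=; have [s hs] := fg_words (Pfg G PG).
  by exists (fun w => wev s w = 1), G, s.
have [f hf] := choice h; exists f => C D CD.
have [G [s [CG hs Cs]]] := hf C; have [H [t [DH ht Dt]]] := hf D.
apply: eq_sig_hprop => [K|]; first exact: Prop_irrelevance.
rewrite CG DH.
apply/isomorphic_eq/(isomorphic_relators hs ht) => w.
by rewrite -Cs -Dt CD.
Qed.

Definition bits := nat -> bool.

Section Family.
Variables (P : groupType -> Prop) (G : groupType) (s : bits -> seq G) (wd : nat -> word).
Hypothesis Ps : forall x, P (spangrp (s x)).
Hypothesis swd : forall x m, wev (s x) (wd m) = 1 <-> x m = false.

Let iso_class x : isomorphism_types P := exist _ (isomorphic (spangrp (s x))) (ex_intro2 _ _ _ (Ps x) erefl).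

(** An isomorphism carries the generators for [y] to a tuple in the group of [x]; evaluating the
    words [wd] on that tuple recovers [y]. Tuples are named by lists of words, so they are
    countable. *)
Lemma iso_class_countable x : exists D : seq word -> bits,
  forall y, iso_class x = iso_class y -> exists k, D k = y.
Proof.
pose gx := span_gens (s x).
exists (fun ws m => `[< wev (map (wev gx) ws) (wd m) <> 1 >]) => y /(congr1 sval) /= e.
have [f [g fK gK]] : isomorphic (spangrp (s y)) (spangrp (s x)).
  by rewrite -e; apply: isomorphic_refl.
have lift (l : seq (spangrp (s x))) : exists ws, map (wev gx) ws = l.
  elim: l => [|z l [ws <-]]; first by exists [::].
  by have [w ->] := span_wev z; exists (w :: ws).
have [ws hws] := lift (map f (span_gens (s y))); exists ws; apply/funext => m.
rewrite hws -wev_map.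
have f1 : f 1 = 1 by apply: (mulgI (f 1)); rewrite -gmulfM !mulg1.
have := swd y m; rewrite -val_wev => ym.
case ymE : (y m); apply/asboolP.
  rewrite -f1 => /(can_inj fK) e1.
  by have /ym := congr1 val e1; rewrite ymE.
by apply; rewrite -f1; congr (f _); apply: val_inj; apply/ym.
Qed.

(* Koenig: if no coordinate [pr k] mapped the [k]-th codes of all classes onto
   [bits], a diagonal sequence would avoid every code of every class. *)
Lemma iso_class_inj : exists f : bits -> isomorphism_types P, injective f.
Proof.
have [psi hpsi] : exists psi : isomorphism_types P -> bits, forall x, iso_class (psi (iso_class x)) = iso_class x.
  have h (C : isomorphism_types P) : exists y, forall x, C = iso_class x -> iso_class y = C.
    have [[y Cy]|nC] := pselect (exists y, C = iso_class y); first by exists y.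
    by exists (fun=> true) => x Cx; exfalso; apply: nC; exists x.
  by have [psi hpsi] := choice h; exists psi => x; apply: (hpsi _ x).
have [D hD] := choice (fun x => iso_class_countable x).
have cover y : exists C k, D (psi C) k = y.
  by exists (iso_class y); apply: hD; apply: hpsi.
pose pr (k : seq word) (y : bits) : bits := fun m => y (pickle (pickle k, m)).
have [k hk] : exists k : seq word, forall r, exists C, pr k (D (psi C) k) = r.
  apply: contrapT => nk.
  have h (k : seq word) : exists r, forall C, pr k (D (psi C) k) <> r.
    apply: contrapT => nr; apply: nk; exists k => r.
    by apply: contrapT => nC; apply: nr; exists r => C e; apply: nC; exists C.
  have [r hr] := choice h.
  pose y : bits := fun j => if (unpickle j : option (nat * nat)) is Some (n, m) then
     if (unpickle n : option (seq word)) is Some k then r k m else true else true.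
  have [C [k Cy]] := cover y; apply: (hr k C).
  by apply/funext => m; rewrite /pr Cy /y !pickleK.
have [f hf] := choice hk; exists f => a b ab.
by rewrite -[a]hf -[b]hf ab.
Qed.

End Family.
End Counting.

(** * Comparison with the real line *)

Section Reals.
Variable R : realType.

(** A real is determined by the rationals below it. *)
Lemma real_to_bits : exists f : R -> bits, injective f.
Proof.
exists (fun r n => if (unpickle n : option rat) is Some q then ratr q < r else false).
suff lt (x y : R) : x < y -> (fun n => if (unpickle n : option rat) is Some q then ratr q < x else false) <>
   (fun n => if (unpickle n : option rat) is Some q then ratr q < y else false).
  move=> x y e; by case: (ltgtP x y) => // /lt; rewrite e; case.
move=> xy; have [q] := rat_in_itvoo xy; rewrite in_itv /= => /andP[xq qy].
move=> e; have := congr1 (@^~ (pickle q)) e; cbv beta; rewrite pickleK qy => h.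
by have := lt_trans h xq; rewrite ltxx.
Qed.

(** Partial sums in base [3] with digits [0] and [1]: all terms after the [n]-th add up to at most
    half of [3 ^- n], so distinct sequences have distinct limits. *)
Definition cut (x : bits) (n : nat) : R := \sum_(i < n) (x i)%:R / 3 ^+ i.

Lemma cutS x n : cut x n.+1 = cut x n + (x n)%:R / 3 ^+ n.
Proof. by rewrite /cut big_ord_recr. Qed.

Lemma cut_le x k d : cut x (k + d) <= cut x k + 3 / 2 * ((3 ^+ k)^-1 - (3 ^+ (k + d))^-1).
Proof.
elim: d => [|d IH]; first by rewrite addn0 subrr mulr0 addr0.
rewrite addnS cutS exprS invfM.
set e := (3 ^+ (k + d))^-1; have e0 : 0 <= e by rewrite invr_ge0 exprn_ge0.
have : (x (k + d)%N)%:R * e <= e by case: (x _); rewrite ?mul1r ?mul0r.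
move: IH; rewrite -/e. lra.
Qed.

Lemma cut_mono x k d : cut x k <= cut x (k + d).
Proof.
elim: d => [|d IH]; first by rewrite addn0.
rewrite addnS cutS (le_trans IH) // lerDl.
by rewrite divr_ge0 // exprn_ge0.
Qed.

Lemma bits_to_real : exists f : bits -> R, injective f.
Proof.
pose S (x : bits) : set R := [set cut x n | n in setT]%classic.
have ub x k : ubound (S x) (cut x k + 3 / 2 * (3 ^+ k)^-1).
  move=> _ [n _ <-]; have [kn|nk] := leqP k n.
    have := cut_le x k (n - k); rewrite subnKC //.
    have : 0 <= (3 ^+ n)^-1 :> R by rewrite invr_ge0 exprn_ge0.
    lra.
  have := cut_mono x n (k - n); rewrite subnKC ?(ltnW nk) //.
  have : 0 <= (3 ^+ k)^-1 :> R by rewrite invr_ge0 exprn_ge0.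
  lra.
have hs x : has_sup (S x).
  by split; [exists (cut x 0), 0%N | exists (cut x 0 + 3 / 2 * (3 ^+ 0)^-1); apply: ub].
have sup_ub' x k : sup (S x) <= cut x k + 3 / 2 * (3 ^+ k)^-1.
  by apply: ge_sup; [case: (hs x) | apply: ub].
have sup_lb x k : cut x k <= sup (S x).
  by apply: ub_le_sup; [case: (hs x) | exists k].
exists (fun x => sup (S x)) => x y e; apply/funext.
suff main n : forall k, (k < n)%N -> x k = y k by move=> k; apply: (main k.+1).
elim: n => // n IH k; rewrite ltnS leq_eqVlt => /orP[/eqP ->|/IH //].
have cn : cut x n = cut y n by apply: eq_bigr => i _; rewrite IH.
have e0 : 0 < (3 ^+ n)^-1 :> R by rewrite invr_gt0 exprn_gt0.
have lx := sup_lb x n.+1; have ly := sup_lb y n.+1.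
have ux := sup_ub' x n.+1; have uy := sup_ub' y n.+1.
move: lx ly ux uy; rewrite !cutS cn e exprS invfM.
by case: (x n); case: (y n) => //=; lra.
Qed.

Lemma bits_of_pred (T : countType) : exists f : (T -> Prop) -> bits, injective f.
Proof.
exists (fun S n => if unpickle n is Some w then `[< S w >] else false) => S S' e.
apply/funext => w; have := congr1 (@^~ (pickle w)) e; cbv beta; rewrite !pickleK => h.
by apply/propext; split=> /asboolP; [rewrite h | rewrite -h] => /asboolP.
Qed.

(** Cantor-Bernstein is applied to [R] and the image of [g], both sets of reals, because the
    universe of [T] may be too large for [#=]. *)
Lemma continuum_manyP (T : Type) (f : R -> T) (g : T -> R) :
  injective f -> injective g -> continuum_many R T.
Proof.
move=> fi gi; pose A : set R := [set r | exists t, g t = r]%classic.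
suff cA : ([set: R] #= A)%card.
  pose U : pointedType := HB.pack (Real.sort R) (isPointed.Build (Real.sort R) 0).
  have [h [hA hi hs]] := elimT (@card_set_bijP R U setT A) cA.
  have [F hF] : exists F : R -> T, forall r, g (F r) = h r.
    have [F hF] := choice (fun r => hA r I : exists t, g t = h r).
    by exists F.
  have [F' hF'] : exists F' : T -> R, forall t, h (F' t) = g t.
    have k t : exists r, h r = g t.
      by have [|r _ hr] := hs (g t); [exists t | exists r].
    by have [F' hF'] := choice k; exists F'.
  exists F, F' => [r|t]; last by apply: gi; rewrite hF hF'.
  by apply: hi; rewrite ?in_setT // hF' hF.
apply: Cantor_Bernstein; last exact: card_leT.
have /card_le_eql <- : ((g \o f) @` [set: R] #= [set: R])%card.
  by apply: inj_card_eq => x y _ _ /gi/fi.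
by apply: subset_card_le => _ [r _ <-]; exists (f r).
Qed.
End Reals.

(** * The family of groups *)

Section LeftOrder.

Definition lex_lt (f g : oaut rat) : Prop :=
  exists2 q : rat, f q < g q & forall p, (pickle p < pickle q)%N -> f p = g p.

Lemma lex_lt_trans f g h : lex_lt f g -> lex_lt g h -> lex_lt f h.
Proof.
move=> [q fg q1] [p gh p1]; case: (ltngtP (pickle p) (pickle q)) => [pq|qp|e].
- by exists p => [|r rp]; [rewrite q1 | rewrite q1 ?p1 // (ltn_trans rp)].
- by exists q => [|r rq]; [rewrite -p1 | rewrite q1 ?p1 // (ltn_trans rq)].
have pq : p = q by apply: (pcan_inj pickleK).
by subst p; exists q => [|r rq]; [exact: lt_trans fg gh | rewrite q1 ?p1].
Qed.

Lemma lex_lt_irr f : ~ lex_lt f f.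
Proof. by case=> q; rewrite ltxx. Qed.

Lemma lex_lt_total f g : f = g \/ lex_lt f g \/ lex_lt g f.
Proof.
have [fg|fg] := pselect (f =1 g); [by left; apply: oautP | right].
pose P : pred nat := fun n => `[< exists2 q : rat, pickle q = n & f q <> g q >].
have ex : exists n, P n.
  apply: contra_notP fg => h q; apply: contrapT => fgq; apply: h.
  by exists (pickle q); apply/asboolP; exists q.
case: (ex_minnP ex) => _ /asboolP[q <- fgq] nmin.
have pq p : (pickle p < pickle q)%N -> f p = g p.
  move=> h; apply: contrapT => h'; move: h; rewrite ltnNge nmin //.
  by apply/asboolP; exists p.
case: (ltgtP (f q) (g q)) fgq => // h _; [left|right]; exists q => // p /pq //.
Qed.

(** Left multiplication applies an increasing map to both values, so the first point of difference
    and the direction there are kept. *)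
Lemma left_orderable_spangrp (s : seq (oaut rat)) : left_orderable (spangrp s).
Proof.
exists (fun x y => `[< x = y \/ lex_lt (val x) (val y) >]); split.
- move=> x y /andP[/asboolP[//|xy] /asboolP[->//|yx]].
  by case: (lex_lt_irr (lex_lt_trans xy yx)).
- move=> y x z /asboolP[->//|xy] /asboolP[<-|yz]; apply/asboolP; right=> //.
  exact: lex_lt_trans xy yz.
- move=> x y; apply/orP; case: (lex_lt_total (val x) (val y)) => [/val_inj ->|[h|h]].
  + by left; apply/asboolP; left.
  + by left; apply/asboolP; right.
  + by right; apply/asboolP; right.
- move=> x y z /asboolP[->|[q xy hq]]; apply/asboolP; [by left | right].
  exists q => [|p pq]; rewrite !valM !oautME; first exact: ofwd_lt.
  by rewrite hq.
Qed.
End LeftOrder.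

(** * Choice of the sequences and simplicity *)

Section GroupFamily.
Local Notation F := rat.
Local Notation bshift := (bshift F).
Local Notation shrink := (shrink F).
Local Notation second_shift := (second_shift F).
Implicit Types a b : nat -> oaut F.

Lemma inner1 : inner (1%g : oaut F).
Proof. by exists (1/2). Qed.

Lemma commg_factors : exists cf : oaut F -> oaut F * oaut F, forall z,
  [/\ inner (cf z).1, inner (cf z).2 & inner z -> z = [~ (cf z).1, (cf z).2]%g].
Proof.
have h (z : oaut F) : exists h : oaut F * oaut F,
    [/\ inner h.1, inner h.2 & inner z -> z = [~ h.1, h.2]%g].
  have [zi|nz] := pselect (inner z).
    by have [h [h1 h2] e] := inner_commg zi; exists h.
  by exists (1%g, 1%g); split => //; apply: inner1.
by have [cf hcf] := choice h; exists cf.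
Qed.

(** The parameters are rational triples, so countably many squeezers suffice and one sequence can
    list them. *)
Lemma squeezers : exists sq : F * F * F -> oaut F, (forall t, inner (sq t)) /\
  forall u c e : F, 0 < u < 1 -> -1 < c -> c < e -> e < 1 ->
  forall x, -u <= x <= u -> c < sq (u, c, e) x < e.
Proof.
have h (t : F * F * F) : exists p : oaut F, inner p /\
   (0 < t.1.1 < 1 -> -1 < t.1.2 -> t.1.2 < t.2 -> t.2 < 1 ->
    forall x, - t.1.1 <= x <= t.1.1 -> t.1.2 < p x < t.2).
  have [[h1 [h2 [h3 h4]]]|n] := pselect (0 < t.1.1 < 1 /\ -1 < t.1.2 /\ t.1.2 < t.2 /\ t.2 < 1).
    by have [p pi hp] := squeeze_exists h1 h2 h3 h4; exists p.
  by exists 1%g; split; [exact: inner1 | move=> h1 h2 h3 h4; case: n].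
have [sq hsq] := choice h; exists sq; split=> [t|u c e].
  by case: (hsq t).
by case: (hsq (u, c, e)).
Qed.

(** A sequence of naturals taking every value infinitely often; the successor avoids the valuation
    of [0]. *)
Definition v2S (j : nat) := logn 2 j.+1.

Lemma logn2_odd k : logn 2 (2 * k).+1 = 0%N.
Proof. by rewrite logn_coprime // coprime2n /= oddM. Qed.

Lemma v2S_unbounded n N : exists2 j, (N <= j)%N & v2S j = n.
Proof.
have p : (0 < 2 ^ n * (2 * N).+1)%N by rewrite muln_gt0 expn_gt0.
exists (2 ^ n * (2 * N).+1).-1.
  rewrite -ltnS prednK //; apply: leq_trans (leq_pmull _ _); last by rewrite expn_gt0.
  by rewrite ltnS leq_pmull.
by rewrite /v2S prednK // lognM ?expn_gt0 // pfactorK // logn2_odd addn0.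
Qed.

Lemma bshift_neq1 : bshift <> 1%g.
Proof.
move/emb_eq1 => /(congr1 (fun f : oaut F => f 0)); rewrite transE oaut1E add0r.
by apply/eqP; rewrite oner_eq0.
Qed.

Definition tr_word (k : nat) : word := nseq k (0%N, false).
Definition commg_word (v w : word) : word := winv v ++ winv w ++ v ++ w.
(** Letters index [gens]: [0] is the translation by [1/8], taken [8 * 2 ^ j] times, and [6], [7] are
    the wild generators. *)
Definition isolate_word (j : nat) : word :=
  commg_word [:: (6, false)]
    (tr_word (8 * 2 ^ j) ++ [:: (7, false)] ++ winv (tr_word (8 * 2 ^ j))).
(** Even indices have [v2S] equal to [0] and carry the free bits. *)
Definition bit_word (m : nat) : word := winv (isolate_word m.*2) ++ isolate_word m.*2.+1.

Lemma wev_tr_word (s : seq (oaut F)) k : nth 1%g s 0 = trans (1/8) ->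
  wev s (tr_word k) = trans (k%:R / 8).
Proof.
move=> s0; elim: k => [|k IH] /=.
  by apply: oautP => x; rewrite transE mul0r addr0.
by rewrite IH s0 transM; congr trans; rewrite -natr1; field.
Qed.

Lemma wev_isolate_word a b j : wev (gens a b) (isolate_word j) = isolate a b j.
Proof.
rewrite /isolate_word /commg_word !wev_cat !wev_inv !wev_cat !wev_inv.
rewrite (@wev_tr_word (gens a b)) // (_ : (8 * 2 ^ j)%:R / 8 = (pow2 j)%:~R); last first.
  by rewrite natrM mulrC mulKf.
by rewrite /= !mulg1 /isolate /commg /conjg !invgK !mulgA.
Qed.

Lemma wev_bit_word a b m :
  wev (gens a b) (bit_word m) = 1%g <-> [~ a m.*2, b m.*2]%g = 1%g.
Proof. by rewrite /bit_word wev_cat wev_inv !wev_isolate_word; apply: isolate_eq1. Qed.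

Section OneGroup.
Variables (a b : nat -> oaut F) (L : seq (oaut F)).
Hypothesis ha : forall i, inner (a i).
Hypothesis hb : forall i, inner (b i).
Hypothesis hL : forall S N a b, subgrp S -> normal_in S N ->
  (forall m, S (trans (m%:~R / 8))) -> (forall g, g \in gens a b -> S g) ->
  (forall i, fixes_off (-1) 1 (a i)) -> (forall i, fixes_off (-1) 1 (b i)) ->
  (forall l, l \in L -> N (diag l)) -> forall g, g \in gens a b -> N g.

(** [on_commg] reaches only the levels up to [j.+1]; recurrence supplies arbitrarily large [j],
    hence all levels. *)
Definition recurrent z := forall N, exists2 j, (N <= j)%N & [~ a j, b j]%g = z.

Hypothesis L_commg : forall l, l \in L -> exists2 h : oaut F * oaut F,
  [/\ inner h.1, inner h.2, recurrent h.1 & recurrent h.2] & l = [~ h.1, h.2]%g.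
Hypothesis squeeze_rec : squeezing recurrent.

Let S := wordset (gens a b).

Lemma words_subgrp : subgrp S.
Proof.
split; first by exists [::].
  by move=> _ _ [v ->] [w ->]; exists (v ++ w); rewrite wev_cat.
by move=> _ [v ->]; exists (winv v); rewrite wev_inv.
Qed.

Lemma words_gens g : g \in gens a b -> S g.
Proof. by move=> /(nthP 1%g) [i _ <-]; exists [:: (i, false)]; rewrite /= mulg1. Qed.

Lemma words_trans m : S (trans (m%:~R / 8)).
Proof.
have Sn (k : nat) : S (trans (k%:R / 8)) by exists (tr_word k); rewrite wev_tr_word.
case: m => k; first exact: Sn.
have := subgrpV words_subgrp (Sn k.+1); rewrite transV.
by rewrite NegzE mulrNz mulNr.
Qed.

Lemma words_left_periodic f : S f -> left_periodic f.
Proof.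
have lp := left_periodic_subgrp F; move=> [w ->]; elim: w => [|[i c] w IH].
  exact: (subgrp1 lp).
have g_lp : left_periodic (nth 1%g (gens a b) i).
  have [ig|gi] := ltnP i (size (gens a b)); last first.
    by rewrite nth_default //; apply: (subgrp1 lp).
  case: i ig => [|[|[|[|[|[|[|[|i]]]]]]]] // _; rewrite [nth _ _ _]/=.
  - exact: left_periodic_trans.
  - exact: left_periodic_diag.
  - exact: left_periodic_diag.
  - exact: left_periodic_diag.
  - exact: left_periodic_diag.
  - exact: left_periodic_diag.
  - exact: left_periodic_wild.
  - exact: left_periodic_wild.
apply: (subgrpM lp) => //.
by case: c => //; apply: (subgrpV lp).
Qed.

Lemma words_recurrent z i : recurrent z -> S (on (dvd2 i) z).
Proof.
move=> /(_ i) [j ij <-]; apply: on_commg; rewrite ?(leqW ij) //.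
- exact: words_subgrp.
- by move=> m; have := words_trans (8 * m); rewrite intrM mulrC mulKf.
- by apply: words_gens; rewrite !inE eqxx ?orbT.
- by apply: words_gens; rewrite !inE eqxx ?orbT.
- by apply: words_gens; rewrite !inE eqxx ?orbT.
- by apply: words_gens; rewrite !inE eqxx ?orbT.
- by apply: words_gens; rewrite !inE eqxx ?orbT.
- exact: inner_fixes.
- exact: inner_fixes.
Qed.

Lemma gens_simple : simple_group (spangrp (gens a b)).
Proof.
apply: span_simple => [e|N N1 NB NS NJ [w Nw w1]].
  have : S (trans (1/8)) by apply: words_gens; rewrite !inE eqxx.
  rewrite /S e => /(congr1 (fun f : oaut F => f 0)); rewrite transE oaut1E add0r.
  by apply/eqP.
have NV x : N x -> N x^-1%g by move=> Nx; rewrite -div1g; apply: NB.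
have hN : subgrp N.
  by split=> // x y Nx Ny; rewrite -[y]invgK; apply: NB => //; apply: NV.
have nN : normal_in S N by [].
suff NL l : l \in L -> N (diag l).
  move=> i ig; apply: (hL words_subgrp nN words_trans words_gens _ _ NL); last exact: mem_nth.
    by move=> k; apply: inner_fixes.
  by move=> k; apply: inner_fixes.
move=> /L_commg [[f g] /= [fi gi fr gr] ->].
apply: (normal_contains words_subgrp words_left_periodic words_trans nN Nw w1) => //.
- move=> u c e u1 c1 ce e1; have [p pr hp] := squeeze_rec u1 c1 ce e1.
  by exists p => // i; apply: words_recurrent.
- by move=> i; apply: words_recurrent.
- by move=> i; apply: words_recurrent.
Qed.
End OneGroup.

Lemma simple_family : exists (s : bits -> seq (oaut F)) (wd : nat -> word),
  (forall x, simple_group (spangrp (s x))) /\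
  (forall x m, wev (s x) (wd m) = 1%g <-> x m = false).
Proof.
have [L Li hL] := gens_in_normal F.
have [cf hcf] := commg_factors; have [sq [sqi hsq]] := squeezers.
have cf1 z : inner (cf z).1 by case: (hcf z).
have cf2 z : inner (cf z).2 by case: (hcf z).
have cfE z : inner z -> z = [~ (cf z).1, (cf z).2]%g by case: (hcf z).
(* Countably many requests: both commutator factors of each element of [L], and all the
   squeezers. *)
pose I := ((nat * bool) + (F * F * F))%type.
pose req (i : I) := match i with
  | inl (k, c) => let h := cf (nth 1%g L k) in if c then h.2 else h.1
  | inr t => sq t end.
have reqi i : inner (req i) by case: i => [[k []]|t] /=.
(* Valuation [0] holds the free bits. Valuation [n.+1] occurs infinitely often and serves the
   request coded by [n], which makes every request recurrent. *)
pose target (x : bits) j := match v2S j with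
  | 0 => if x j./2 then bshift else 1%g
  | n.+1 => if (unpickle n : option I) is Some i then req i else 1%g end.
have targeti x j : inner (target x j).
  rewrite /target; case: (v2S j) => [|n]; last by case: (unpickle n) => [i|]; [exact: reqi | exact: inner1].
  by case: (x _); [exact: inner_emb | exact: inner1].
pose a x j := (cf (target x j)).1; pose b x j := (cf (target x j)).2.
have abE x j : [~ a x j, b x j]%g = target x j by rewrite -cfE.
have rec x i : recurrent (a x) (b x) (req i).
  move=> N; have [j Nj jE] := v2S_unbounded (pickle i).+1 N.
  by exists j => //; rewrite abE /target jE pickleK.
exists (fun x => gens (a x) (b x)), bit_word; split=> [x|x m].
  apply: (@gens_simple _ _ L) => [i|i|//|l lL|u c e u1 c1 ce e1].
  - exact: cf1.
  - exact: cf2.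
  - exists (cf l); last exact/cfE/Li.
    split; [exact: cf1 | exact: cf2 | |].
      by have := rec x (inl (index l L, false)); rewrite /req nth_index.
    by have := rec x (inl (index l L, true)); rewrite /req nth_index.
  - by exists (sq (u, c, e)); [exact: (rec x (inr (u, c, e))) | exact: hsq].
rewrite wev_bit_word abE /target /v2S -mul2n logn2_odd mul2n doubleK.
by case: (x m); split=> // /bshift_neq1.
Qed.

End GroupFamily.

Theorem corollary1p5 (R : realType) :
  continuum_many R (isomorphism_types (fun G : groupType =>
    [/\ finitely_generated G, simple_group G & left_orderable G])).
Proof.
have [s [wd [simp swd]]] := simple_family.
set P := fun G : groupType => _.
have Ps x : P (spangrp (s x)).
  by split; [exact: span_fg | exact: simp | exact: left_orderable_spangrp].
have [f fi] := iso_class_inj Ps swd.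
have [g gi] : exists g : isomorphism_types P -> word -> Prop, injective g.
  by apply: isomorphism_types_inj => G [].
have [h hi] := real_to_bits R; have [k ki] := bits_to_real R.
have [l li] := bits_of_pred word.
(* Reals inject into classes through bit sequences and the family; classes inject into reals through
   sets of relators. *)
apply: (@continuum_manyP _ _ (f \o h) (k \o l \o g)).
  exact: (inj_comp fi hi).
exact: (inj_comp (inj_comp ki li) gi).
Qed.
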